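(* Consider the quadrotor dynamics $$\dot x=v,\quad m\dot v=mge_3-fRe_3+W_x(x,v,R,\Omega)\theta_x,\quad \dot R=R\hat\Omega,\quad J\dot\Omega+\Omega\times J\Omega=M+W_R(x,v,R,\Omega)\theta_R,$$ and a smooth attitude command $R_d(t)\in\mathsf{SO}(3)$ with $\dot R_d=R_d\hat\Omega_d$, where $\Omega_d(t)\in\mathbb{R}^3$ is uniformly bounded. Define $e_R=\frac12(R_d^TR-R^TR_d)^\vee$ and $e_\Omega=\Omega-R^TR_d\Omega_d$. Let the control moment and the adaptive law be $$M=-k_Re_R-k_\Omega e_\Omega-W_R\bar\theta_R+(R^TR_d\Omega_d)^\wedge JR^TR_d\Omega_d+JR^TR_d\dot\Omega_d,$$ $$\dot{\bar\theta}_R=\gamma_RW_R^T(e_\Omega+c_2e_R),$$ where $k_R,k_\Omega,c_2,\gamma_R$ are positive constants and $\bar\theta_R$ is the estimate of $\theta_R$. Suppose that, for the positive constants $k_R,k_\Omega$, the constants $c_2,B_2$ are chosen such that $$\|2J-\mathrm{tr}[J]I\|\,\|\Omega_d\|\le B_2,\qquad c_2<\min\left\{\frac{\sqrt{k_R\lambda_m}}{\lambda_M},\ \frac{4k_Rk_\Omega}{8k_R\lambda_M+(k_\Omega+B_2)^2}\right\}.$$ Then the zero equilibrium of the tracking errors $(e_R,e_\Omega)=(0,0)$ is stable in the sense of Lyapunov, $e_R,e_\Omega\to0$ as $t\to\infty$, and furthermore the estimation error $\tilde\theta_R=\theta_R-\bar\theta_R$ is uniformly bounded.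
   Context: State: position $x\in\mathbb{R}^3$, velocity $v\in\mathbb{R}^3$, attitude $R\in\mathsf{SO}(3)=\{R\in\mathbb{R}^{3\times3}: R^TR=I,\ \det R=1\}$ (mapping the body-fixed frame to the inertial frame), and body-frame angular velocity $\Omega\in\mathbb{R}^3$. The constants are the mass $m>0$, the inertia matrix $J\in\mathbb{R}^{3\times3}$ (symmetric positive definite) and the gravitational acceleration $g$; $e_3=[0,0,1]^T$. The control inputs are the total thrust $f\in\mathbb{R}$ and the total moment $M\in\mathbb{R}^3$; in the attitude controlled flight mode considered here the choice of thrust $f$ is not specified. The hat map $\hat{\cdot}$ (also written $(\cdot)^\wedge$) sends $x\in\mathbb{R}^3$ to the skew-symmetric matrix $\hat x$ with $\hat xy=x\times y$ for all $y\in\mathbb{R}^3$; $(\cdot)^\vee$ is its inverse. $W_x,W_R$ are known functions of the state with values in $\mathbb{R}^{3\times P}$; $\theta_x,\theta_R\in\mathbb{R}^{P}$ are fixed unknown parameters. It is assumed that $\|W_x\|\le B_{W_x}$, $\|\theta_x\|\le B_\theta$, $\|\theta_R\|\le B_\theta$ for constants $B_{W_x},B_\theta>0$. $\lambda_m,\lambda_M$ denote the minimum and maximum eigenvalues of $J$, and $\|A\|$ is the matrix two-norm.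
   Formalization: e_Ω→0 is proved only for solutions along which W_R stays bounded (false otherwise). Stability is for initial attitudes with ½tr(I−R_d^T R)≤ψ, any ψ<2 (e_R also vanishes at the unstable rotations by π), and with the initial estimation error small too. *)

(* Defs.v *)
From HB Require Import structures.
From mathcomp Require Import all_boot all_order all_algebra.
From mathcomp Require Import all_classical all_reals all_analysis.

Set Implicit Arguments.
Unset Strict Implicit.
Unset Printing Implicit Defensive.

Import Order.TTheory GRing.Theory Num.Theory.
Import numFieldNormedType.Exports.

Local Open Scope classical_set_scope.
Local Open Scope ring_scope.

(* The canonical norm of 'M[K]_(m, n) in the library is the entrywise max norm;
   it is used below only through the topology it induces. The two-norms of
   vectors and matrices are [norm2] and [mxnorm2]. *)
Definition norm2 (K : realType) (n : nat) (u : 'cV[K]_n) : K :=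
  Num.sqrt (\sum_i u i 0 ^+ 2).

Definition mxnorm2 (K : realType) (m n : nat) (A : 'M[K]_(m, n)) : K :=
  sup [set norm2 (A *m u) | u in [set u : 'cV[K]_n | norm2 u <= 1]].

Definition posdefmx (K : realType) (n : nat) (A : 'M[K]_n) : Prop :=
  A^T = A /\ forall u : 'cV[K]_n, u != 0 -> 0 < (u^T *m A *m u) 0 0.

Definition SO3 (K : realType) (A : 'M[K]_3) : Prop :=
  A^T *m A = 1%:M /\ \det A = 1.

Definition col3 (K : realType) (a b c : K) : 'cV[K]_3 :=
  \col_(i < 3) nth 0 [:: a; b; c] i.

Definition cross (K : realType) (x y : 'cV[K]_3) : 'cV[K]_3 :=
  col3 (x 1 0 * y 2 0 - x 2 0 * y 1 0)
       (x 2 0 * y 0 0 - x 0 0 * y 2 0)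
       (x 0 0 * y 1 0 - x 1 0 * y 0 0).

Definition hat (K : realType) (x : 'cV[K]_3) : 'M[K]_3 :=
  \matrix_(i < 3, j < 3)
    nth 0 (nth [::] [:: [:: 0; - x 2 0; x 1 0];
                        [:: x 2 0; 0; - x 0 0];
                        [:: - x 1 0; x 0 0; 0]] i) j.

(* The inverse of [hat] on skew-symmetric matrices (see [hatK], [veeK]);
   the value on other matrices is irrelevant. *)
Definition vee (K : realType) (A : 'M[K]_3) : 'cV[K]_3 :=
  col3 (A 2 1) (A 0 2) (A 1 0).

Lemma hat_mul (K : realType) (x y : 'cV[K]_3) : hat x *m y = cross x y.
Proof.
apply/matrixP => i j; rewrite ord1 !mxE !big_ord_recl big_ord0 !mxE /=.
have -> : lift ord0 (ord0 : 'I_2) = 1 :> 'I_3 by apply/val_inj.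
have -> : lift ord0 (lift ord0 (ord0 : 'I_1)) = 2 :> 'I_3 by apply/val_inj.
have -> : ord0 = 0 :> 'I_3 by apply/val_inj.
case: i => -[|[|[|//]]] p /=.
- by rewrite mul0r add0r addr0 mulNr addrC.
- by rewrite mul0r add0r addr0 mulNr.
- by rewrite mul0r !addr0 mulNr addrC.
Qed.

Lemma hatK (K : realType) : cancel (@hat K) (@vee K).
Proof.
move=> x; apply/matrixP => i j; rewrite ord1 !mxE /=.
by case: i => -[|[|[|//]]] p /=; congr (x _ _); apply/val_inj.
Qed.

Lemma veeK (K : realType) (A : 'M[K]_3) : A^T = - A -> hat (vee A) = A.
Proof.
move=> skA; have sk i j : A i j = - A j i.
  by have /matrixP/(_ j i) := skA; rewrite !mxE.
have dg i : A i i = 0.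
  by apply/eqP; have /eqP := sk i i; rewrite -addr_eq0 -mulr2n mulrn_eq0.
have ordE (i : 'I_3) : [\/ i = 0, i = 1 | i = 2].
  case: i => -[|[|[|//]]] p;
    [apply: Or31 | apply: Or32 | apply: Or33]; exact/val_inj.
apply/matrixP => i j; rewrite !mxE.
by case: (ordE i) => ->; case: (ordE j) => ->; rewrite /= ?dg // sk ?opprK.
Qed.

Definition e3 (K : realType) : 'cV[K]_3 := col3 0 0 1.

(* On SO(3), [att_fun Rd R] = 1 - cos a with a the angle of the rotation
   Rd^T *m R, so that it lies in [0, 2], vanishes only at R = Rd, and equals 2
   exactly at the rotations by pi away from Rd, where [err_R] vanishes too. *)
Definition att_fun (K : realType) (Rd R : 'M[K]_3) : K :=
  2^-1 * \tr (1%:M - Rd^T *m R).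

Definition err_R (K : realType) (Rd R : 'M[K]_3) : 'cV[K]_3 :=
  2^-1 *: vee (Rd^T *m R - R^T *m Rd).

Definition err_Omega (K : realType) (Rd R : 'M[K]_3) (Omd Om : 'cV[K]_3) :
    'cV[K]_3 :=
  Om - R^T *m Rd *m Omd.

(* [WRs] is the value of W_R at the current state, [thb] the estimate of
   theta_R, and [Omd'] the time derivative of [Omd]. *)
Definition control_moment (K : realType) (P : nat) (J : 'M[K]_3) (kR kO : K)
    (Rd : 'M[K]_3) (Omd Omd' : 'cV[K]_3) (R : 'M[K]_3) (Om : 'cV[K]_3)
    (WRs : 'M[K]_(3, P)) (thb : 'cV[K]_P) : 'cV[K]_3 :=
  - (kR *: err_R Rd R) - kO *: err_Omega Rd R Omd Om - WRs *m thb
  + hat (R^T *m Rd *m Omd) *m J *m R^T *m Rd *m Omd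
  + J *m R^T *m Rd *m Omd'.

Definition timespan (K : realType) (t0 : K) (T : \bar K) : set K :=
  [set t | t0 <= t /\ (t%:E < T)%E].

(* Derivatives of a trajectory on [t0, T[ are required only for t0 < t, with
   continuity up to t0: the values of the total functions before t0 do not
   matter, and every solution with a right derivative at t0 is covered. *)
Record quadrotor_dynamics (K : realType) (P : nat) (m g : K) (J : 'M[K]_3)
    (Wx WR : 'cV[K]_3 -> 'cV[K]_3 -> 'M[K]_3 -> 'cV[K]_3 -> 'M[K]_(3, P))
    (thx thR : 'cV[K]_P) (t0 : K) (T : \bar K)
    (f : K -> K) (M : K -> 'cV[K]_3)
    (x v : K -> 'cV[K]_3) (R : K -> 'M[K]_3) (Om : K -> 'cV[K]_3) : Prop := {
  dyn_cont_x : {within timespan t0 T, continuous x};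
  dyn_cont_v : {within timespan t0 T, continuous v};
  dyn_cont_R : {within timespan t0 T, continuous R};
  dyn_cont_Om : {within timespan t0 T, continuous Om};
  dyn_SO3 : forall t, timespan t0 T t -> SO3 (R t);
  dyn_derivable : forall t, timespan t0 T t -> t0 < t ->
    [/\ derivable x t 1, derivable v t 1, derivable R t 1
      & derivable Om t 1];
  dyn_x : forall t, timespan t0 T t -> t0 < t ->
    derive1 x t = v t;
  dyn_v : forall t, timespan t0 T t -> t0 < t ->
    m *: derive1 v t = (m * g) *: e3 K - f t *: (R t *m e3 K)
                   + Wx (x t) (v t) (R t) (Om t) *m thx;
  dyn_R : forall t, timespan t0 T t -> t0 < t ->
    derive1 R t = R t *m hat (Om t);
  dyn_Om : forall t, timespan t0 T t -> t0 < t ->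
    J *m derive1 Om t + cross (Om t) (J *m Om t)
    = M t + WR (x t) (v t) (R t) (Om t) *m thR }.

Record adaptive_law (K : realType) (P : nat)
    (WR : 'cV[K]_3 -> 'cV[K]_3 -> 'M[K]_3 -> 'cV[K]_3 -> 'M[K]_(3, P))
    (c2 gamR : K) (Rd : K -> 'M[K]_3) (Omd : K -> 'cV[K]_3)
    (t0 : K) (T : \bar K)
    (x v : K -> 'cV[K]_3) (R : K -> 'M[K]_3) (Om : K -> 'cV[K]_3)
    (thb : K -> 'cV[K]_P) : Prop := {
  adapt_cont : {within timespan t0 T, continuous thb};
  adapt_derivable : forall t, timespan t0 T t -> t0 < t -> derivable thb t 1;
  adapt_eq : forall t, timespan t0 T t -> t0 < t ->
    derive1 thb t = gamR *: ((WR (x t) (v t) (R t) (Om t))^T *m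
      (err_Omega (Rd t) (R t) (Omd t) (Om t) + c2 *: err_R (Rd t) (R t))) }.

Definition closed_loop (K : realType) (P : nat) (m g : K) (J : 'M[K]_3)
    (Wx WR : 'cV[K]_3 -> 'cV[K]_3 -> 'M[K]_3 -> 'cV[K]_3 -> 'M[K]_(3, P))
    (thx thR : 'cV[K]_P) (kR kO c2 gamR : K)
    (Rd : K -> 'M[K]_3) (Omd : K -> 'cV[K]_3)
    (t0 : K) (T : \bar K) (f : K -> K)
    (x v : K -> 'cV[K]_3) (R : K -> 'M[K]_3) (Om : K -> 'cV[K]_3)
    (thb : K -> 'cV[K]_P) : Prop :=
  quadrotor_dynamics m g J Wx WR thx thR t0 T f
    (fun t => control_moment J kR kO (Rd t) (Omd t) (derive1 Omd t) (R t) (Om t)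
                (WR (x t) (v t) (R t) (Om t)) (thb t))
    x v R Om
  /\ adaptive_law WR c2 gamR Rd Omd t0 T x v R Om thb.

(* Main.v *)
(* Write Q = Rd^T R, so that dQ/dt = Q hat(e_Omega), and let Psi = tr(I - Q)/2,
   for which dPsi/dt = e_R . e_Omega and |e_R|^2 = Psi (2 - Psi). Along
   solutions, J de_Omega/dt = (J e_Omega + d) x e_Omega - k_R e_R
   - k_Omega e_Omega + W_R (theta_R - thb) with |d| <= B_2, and the Lyapunov function
     V = e_Omega . J e_Omega / 2 + k_R Psi + c_2 e_R . J e_Omega
         + |theta_R - thb|^2 / (2 gamma_R)
   satisfies dV/dt <= - al (|e_R|^2 + |e_Omega|^2), the adaptive law cancelling
   the terms in theta_R - thb. The two bounds on c_2 make V and - dV/dt positive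
   definite in the errors. Stability and boundedness follow, and Barbalat's
   argument gives convergence. *)

Require Import Defs.
From HB Require Import structures.
From mathcomp Require Import all_boot all_order all_algebra.
From mathcomp Require Import all_classical all_reals all_analysis.
From mathcomp Require Import ring lra.

Set Implicit Arguments.
Unset Strict Implicit.
Unset Printing Implicit Defensive.

Import Order.TTheory GRing.Theory Num.Theory.
Import numFieldNormedType.Exports.

Local Open Scope classical_set_scope.
Local Open Scope ring_scope.

(** The two factors of |e_R|^2 = Psi (2 - Psi) act differently. Since 2 - Psi is at most 2, Psi is
    at least |e_R|^2 / 2 at every attitude, which is what the lower bound on V asks. From above, Psi
    cannot be controlled by e_R alone, as e_R also vanishes at rotations by pi; hence the condition
    Psi <= psi < 2, imposed at the initial time only. In dV/dt the cross term of V contributes c_2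
    e_R . (J e_Omega x e_Omega), which is cubic, and c_2 de_R/dt . J e_Omega. Both are at most c_2
    lambda_M |e_Omega|^2, because |e_R| <= 1 and |de_R/dt| <= |e_Omega|; this is the origin of the
    term 8 k_R lambda_M. The second inequality is the main fact about rotations. The two bounds on
    c_2 then amount to discriminant conditions for two quadratic forms in |e_R| and |e_Omega|.
    Barbalat's argument is run on |e_R|^2 and |e_Omega|^2 separately: the derivative of the former
    is bounded through e_Omega, that of the latter contains W_R, whence the boundedness of W_R along
    the solution for that conclusion. *)

Definition dot (K : realType) (n : nat) (u v : 'cV[K]_n) : K :=
  \sum_i u i 0 * v i 0.

Lemma dotE (K : realType) (n : nat) (u v : 'cV[K]_n) :
  dot u v = (u^T *m v) 0 0.
Proof. by rewrite mxE; apply: eq_bigr => i _; rewrite mxE. Qed.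

(** * Euclidean scalar product and Cauchy-Schwarz for semidefinite forms *)

Section Dot.
Variables (K : realType) (n : nat).
Implicit Types (u v w : 'cV[K]_n) (A B : 'M[K]_n).

Lemma dotC u v : dot u v = dot v u.
Proof. by apply: eq_bigr => i _; rewrite mulrC. Qed.

Lemma dotDr u v w : dot u (v + w) = dot u v + dot u w.
Proof. by rewrite !dotE mulmxDr mxE. Qed.

Lemma dotZr a u v : dot u (a *: v) = a * dot u v.
Proof. by rewrite !dotE -scalemxAr mxE. Qed.

Lemma dotNr u v : dot u (- v) = - dot u v.
Proof. by rewrite !dotE mulmxN mxE. Qed.

Lemma dotDl u v w : dot (u + v) w = dot u w + dot v w.
Proof. by rewrite dotC dotDr !(dotC w). Qed.

Lemma dotZl a u v : dot (a *: u) v = a * dot u v.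
Proof. by rewrite dotC dotZr (dotC v). Qed.

Lemma dotNl u v : dot (- u) v = - dot u v.
Proof. by rewrite dotC dotNr (dotC v). Qed.

Definition dotlin := (dotDl, dotDr, dotNl, dotNr, dotZl, dotZr).

Lemma dot_ge0 u : 0 <= dot u u.
Proof. by apply: sumr_ge0 => i _; rewrite -expr2 sqr_ge0. Qed.

Lemma dot_eq0 u : dot u u = 0 -> u = 0.
Proof.
move=> /psumr_eq0P u0; apply/matrixP => i j; rewrite ord1 mxE.
apply/eqP; rewrite -sqrf_eq0 expr2; apply/eqP/u0 => // k _.
by rewrite -expr2 sqr_ge0.
Qed.

Lemma norm2_ge0 u : 0 <= norm2 u.
Proof. exact: sqrtr_ge0. Qed.

Lemma norm2_sqr u : norm2 u ^+ 2 = dot u u.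
Proof.
rewrite /norm2; under eq_bigr do rewrite expr2.
by rewrite sqr_sqrtr // dot_ge0.
Qed.

Lemma norm2_le u a : 0 <= a -> (norm2 u <= a) = (dot u u <= a ^+ 2).
Proof. by move=> a0; rewrite -norm2_sqr ler_pXn2r // nnegrE norm2_ge0. Qed.

(** For a > 0, evaluate at the minimum - b / a. The case a = 0 must be covered because the forms
    below are only semidefinite; there, b != 0 would let the linear function take the value -1. *)
Lemma quadratic_ge0_discr (a b c : K) : 0 <= a ->
  (forall t, 0 <= a * t ^+ 2 + 2 * b * t + c) -> b ^+ 2 <= a * c.
Proof.
rewrite le_eqVlt => /predU1P[<-|a0] ge0.
  have [->|b0] := eqVneq b 0; first by rewrite expr0n mul0r.
  have := ge0 (- (c + 1) / (2 * b)).
  suff -> : 0 * (- (c + 1) / (2 * b)) ^+ 2 + 2 * b * (- (c + 1) / (2 * b)) + c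
            = -1 by rewrite oppr_ge0 ler10.
  by field.
have := ge0 (- b / a).
have -> : a * (- b / a) ^+ 2 + 2 * b * (- b / a) + c = (a * c - b ^+ 2) / a.
  by field; rewrite gt_eqF.
by rewrite pmulr_lge0 ?invr_gt0 // subr_ge0.
Qed.

Definition psd B := forall u, 0 <= dot u (B *m u).

Lemma dot_mulmx m (A : 'M[K]_(n, m)) u (v : 'cV[K]_m) :
  dot u (A *m v) = dot (A^T *m u) v.
Proof. by rewrite !dotE trmx_mul trmxK mulmxA. Qed.

(** Stated for a semidefinite form in order to serve three times: for the identity, for the inertia
    matrix, and for mu - A in the Rayleigh bound. *)
Lemma psd_CauchySchwarz B u v : B^T = B -> psd B ->
  dot u (B *m v) ^+ 2 <= dot u (B *m u) * dot v (B *m v).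
Proof.
move=> sB pB; rewrite mulrC; apply: quadratic_ge0_discr; first exact: pB.
move=> t; have := pB (t *: v + u).
rewrite mulmxDr -scalemxAr !dotlin.
have -> : dot v (B *m u) = dot u (B *m v) by rewrite dot_mulmx sB dotC.
by congr (_ <= _); ring.
Qed.

Lemma CauchySchwarz u v : `|dot u v| <= norm2 u * norm2 v.
Proof.
rewrite -(@ler_pXn2r _ 2) ?nnegrE ?mulr_ge0 ?norm2_ge0 //.
rewrite real_normK ?num_real // exprMn !norm2_sqr.
have := @psd_CauchySchwarz 1%:M u v; rewrite !mul1mx; apply.
  exact: trmx1.
by move=> w; rewrite mul1mx dot_ge0.
Qed.

Lemma norm2D u v : norm2 (u + v) <= norm2 u + norm2 v.
Proof.
rewrite norm2_le ?addr_ge0 ?norm2_ge0 //.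
rewrite !dotlin (dotC v u) -!norm2_sqr.
have := le_trans (ler_norm _) (CauchySchwarz u v); lra.
Qed.

Lemma norm2Z a u : norm2 (a *: u) = `|a| * norm2 u.
Proof.
apply/eqP; rewrite -(@eqrXn2 _ 2) ?mulr_ge0 ?norm2_ge0 //.
by rewrite exprMn real_normK ?num_real // !norm2_sqr !dotlin mulrA -expr2.
Qed.

Lemma norm2N u : norm2 (- u) = norm2 u.
Proof. by rewrite -scaleN1r norm2Z normrN1 mul1r. Qed.

Lemma norm2_eq0 u : norm2 u = 0 -> u = 0.
Proof. by move=> u0; apply: dot_eq0; rewrite -norm2_sqr u0 expr0n. Qed.

End Dot.

(** * The matrix two-norm as a supremum *)

Section OperatorNorm.
Variables (K : realType) (m n : nat).
Implicit Types (A : 'M[K]_(m, n)) (u : 'cV[K]_n).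

Lemma norm2_mulmx_frobenius A u :
  norm2 (A *m u) <= Num.sqrt (\sum_i \sum_j A i j ^+ 2) * norm2 u.
Proof.
have F0 : 0 <= \sum_i \sum_j A i j ^+ 2.
  by apply: sumr_ge0 => i _; apply: sumr_ge0 => j _; exact: sqr_ge0.
rewrite norm2_le ?mulr_ge0 ?sqrtr_ge0 ?norm2_ge0 // exprMn sqr_sqrtr //.
rewrite /dot mulr_suml; apply: ler_sum => i _.
have -> : (A *m u) i 0 = dot (row i A)^T u.
  by rewrite mxE; apply: eq_bigr => j _; rewrite !mxE.
have -> : \sum_j A i j ^+ 2 = dot (row i A)^T (row i A)^T.
  by apply: eq_bigr => j _; rewrite !mxE.
rewrite -!norm2_sqr -expr2 -exprMn -[leLHS]real_normK ?num_real //.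
by rewrite ler_pXn2r ?nnegrE ?mulr_ge0 ?norm2_ge0 // CauchySchwarz.
Qed.

(** [sup] takes a default value on unbounded sets, so [mxnorm2] means something only once the
    Frobenius norm is known to bound the set. *)
Lemma has_sup_mxnorm2 A :
  has_sup [set norm2 (A *m u) | u in [set u : 'cV[K]_n | norm2 u <= 1]].
Proof.
split.
  exists (norm2 (A *m 0)), 0 => //=.
  by rewrite norm2_le // /dot big1 ?expr1n ?ler01 // => i _; rewrite mxE mul0r.
exists (Num.sqrt (\sum_i \sum_j A i j ^+ 2)) => _ [u /= u1 <-].
apply: (le_trans (norm2_mulmx_frobenius A u)).
by rewrite -[leRHS]mulr1 ler_wpM2l ?sqrtr_ge0.
Qed.

Lemma norm2_mulmx A u : norm2 (A *m u) <= mxnorm2 A * norm2 u.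
Proof.
have [u0|u0] := eqVneq (norm2 u) 0.
  rewrite u0 mulr0 (norm2_eq0 u0) mulmx0.
  by rewrite norm2_le // /dot big1 ?expr0n // => i _; rewrite mxE mul0r.
have u_gt0 : 0 < norm2 u by rewrite lt_neqAle eq_sym u0 norm2_ge0.
rewrite -ler_pdivrMr //.
have -> : norm2 (A *m u) / norm2 u = norm2 (A *m ((norm2 u)^-1 *: u)).
  by rewrite -scalemxAr norm2Z gtr0_norm ?invr_gt0 // mulrC.
apply: ub_le_sup; first by case: (has_sup_mxnorm2 A).
exists ((norm2 u)^-1 *: u) => //=.
by rewrite norm2Z gtr0_norm ?invr_gt0 // mulVf.
Qed.

Lemma mxnorm2_ge0 A : 0 <= mxnorm2 A.
Proof.
apply: (le_trans (norm2_ge0 (A *m 0))).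
apply: ub_le_sup; first by case: (has_sup_mxnorm2 A).
exists 0 => //=.
by rewrite norm2_le // /dot big1 ?expr1n ?ler01 // => i _; rewrite mxE mul0r.
Qed.

End OperatorNorm.

(** * Extreme eigenvalues bound the Rayleigh quotient *)

Section SymmetricEigenvalues.
Variables (K : realType) (n : nat).
Implicit Types (A : 'M[K]_n) (u : 'cV[K]_n).

Lemma dot_mulmx_frobenius A u :
  dot u (A *m u) <= Num.sqrt (\sum_i \sum_j A i j ^+ 2) * dot u u.
Proof.
apply: (le_trans (ler_norm _)); apply: (le_trans (CauchySchwarz _ _)).
rewrite -norm2_sqr expr2 mulrCA ler_wpM2l ?norm2_ge0 //.
exact: norm2_mulmx_frobenius.
Qed.

(* The supremum mu of the Rayleigh quotient is an eigenvalue: otherwise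
   mu - A is invertible and positive semidefinite, hence bounded below by a
   positive constant, contradicting the choice of mu. *)
Lemma rayleigh_le A (l : K) : A^T = A ->
  (forall a, eigenvalue A a -> a <= l) ->
  forall u, dot u (A *m u) <= l * dot u u.
Proof.
move=> sA Al u; have [->|u0] := eqVneq u 0.
  by rewrite mulmx0 /dot big1 ?mulr0 // => i _; rewrite mxE mul0r.
have sq_gt0 (v : 'cV[K]_n) : v != 0 -> 0 < dot v v.
  move=> v0; rewrite lt_neqAle dot_ge0 andbT eq_sym.
  by apply: contra_neq v0; exact: dot_eq0.
pose S := [set dot v (A *m v) | v in [set v : 'cV[K]_n | dot v v = 1]].
have normalize (v : 'cV[K]_n) : v != 0 -> S (dot v (A *m v) / dot v v).
  move=> /sq_gt0 v0; have vn : norm2 v ^+ 2 != 0 by rewrite norm2_sqr gt_eqF.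
  have {}vn : norm2 v != 0 by rewrite expf_eq0 /= in vn.
  exists ((norm2 v)^-1 *: v) => /=.
    by rewrite !dotlin -norm2_sqr; field.
  by rewrite -scalemxAr !dotlin -norm2_sqr; field.
pose F := Num.sqrt (\sum_i \sum_j A i j ^+ 2).
have ubF : ubound S F.
  by move=> _ [v /= v1 <-]; rewrite -[F]mulr1 -v1 dot_mulmx_frobenius.
pose mu := sup S.
have le_mu v : dot v (A *m v) <= mu * dot v v.
  have [->|v0] := eqVneq v 0.
    by rewrite mulmx0 /dot big1 ?mulr0 // => i _; rewrite mxE mul0r.
  rewrite -ler_pdivrMr ?sq_gt0 //; apply: ub_le_sup; last exact: normalize.
  by exists F.
apply: (le_trans (le_mu u)); rewrite ler_pM2r ?sq_gt0 //; apply: Al.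
pose B := A - mu%:M; rewrite /eigenvalue /eigenspace -/B kermx_eq0.
apply/negP; rewrite row_free_unit => uB.
have sB : (- B)^T = - B by rewrite linearN /B linearB /= tr_scalar_mx sA.
have BE v : dot v (- B *m v) = mu * dot v v - dot v (A *m v).
  by rewrite /B opprB mulmxBl mul_scalar_mx !dotlin.
have pB : psd (- B) by move=> v; rewrite BE subr_ge0.
pose F' := Num.sqrt (\sum_i \sum_j (- invmx B) i j ^+ 2) + 1.
have F'0 : 0 < F' by rewrite ltr_wpDl ?sqrtr_ge0.
suff : mu <= mu - F'^-1 by rewrite lerBrDr gerDl invr_le0 leNgt F'0.
apply: ge_sup; first by exists (dot u (A *m u) / dot u u); exact: normalize.
move=> _ [v /= v1 <-].
(* Cauchy-Schwarz for the form - B = mu - A, at v and (- B)^-1 v, reads 1 <= (mu - v . A v) (v . (-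
   B)^-1 v) for unit v. The second factor is at most F', so mu - v . A v stays above 1 / F'. *)
have := @psd_CauchySchwarz _ _ _ v (- invmx B *m v) sB pB.
rewrite !mulmxA mulNmx mulmxN opprK mulmxV // mul1mx v1 expr1n BE v1 mulr1.
rewrite (dotC _ v) => le1.
have le2 : dot v (- invmx B *m v) <= F'.
  rewrite (le_trans (dot_mulmx_frobenius _ _)) // v1 mulr1.
  by rewrite lerDl.
have ge0 : 0 <= mu - dot v (A *m v) by have := pB v; rewrite BE v1 mulr1.
rewrite lerBrDr -lerBrDl -[F'^-1]mul1r ler_pdivrMr //.
by apply: (le_trans le1); rewrite ler_wpM2l.
Qed.

Lemma rayleigh_ge A (l : K) : A^T = A ->
  (forall a, eigenvalue A a -> l <= a) ->
  forall u, l * dot u u <= dot u (A *m u).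
Proof.
move=> sA Al u.
have sNA : (- A)^T = - A by rewrite linearN /= sA.
have := @rayleigh_le (- A) (- l) sNA _ u.
rewrite mulNmx dotNr mulNr lerN2; apply=> a /eigenvalueP[v vA v0].
rewrite lerNr; apply: Al; apply/eigenvalueP; exists v => //.
by rewrite scaleNr -vA mulmxN opprK.
Qed.

End SymmetricEigenvalues.

(** * Estimates for the inertia matrix *)

Section Posdef.
Variables (K : realType) (n : nat) (J : 'M[K]_n) (lm lM : K).
Hypothesis J_posdef : posdefmx J.
Implicit Types u v : 'cV[K]_n.

Lemma posdefmx_psd : psd J.
Proof.
move=> u; have [->|u0] := eqVneq u 0.
  by rewrite mulmx0 /dot big1 // => i _; rewrite mxE mul0r.
by rewrite dotE mulmxA; apply/ltW/(J_posdef.2).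
Qed.

Lemma posdefmx_eigenvalue_gt0 a : eigenvalue J a -> 0 < a.
Proof.
case/eigenvalueP => v vJ v0.
have vT0 : v^T != 0 by rewrite trmx_eq0.
have := J_posdef.2 _ vT0; rewrite trmxK vJ -scalemxAl mxE.
rewrite -[v in v *m _]trmxK -dotE => h.
by have := dot_ge0 v^T; rewrite le_eqVlt => /predU1P[/esym e|/pmulr_lgt0 <-//];
  rewrite e mulr0 ltxx in h.
Qed.

Hypothesis lM_eigen : eigenvalue J lM.
Hypothesis lM_max : forall a, eigenvalue J a -> a <= lM.

Lemma posdefmx_dot_le u v : `|dot u (J *m v)| <= lM * (norm2 u * norm2 v).
Proof.
have lM0 := ltW (posdefmx_eigenvalue_gt0 lM_eigen).
rewrite -(@ler_pXn2r _ 2) ?nnegrE ?mulr_ge0 ?norm2_ge0 //.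
rewrite real_normK ?num_real //.
apply: (le_trans (psd_CauchySchwarz _ _ J_posdef.1 posdefmx_psd)).
have -> : (lM * (norm2 u * norm2 v)) ^+ 2
  = (lM * norm2 u ^+ 2) * (lM * norm2 v ^+ 2) by ring.
by rewrite !norm2_sqr ler_pM ?posdefmx_psd //; apply: rayleigh_le => //;
  case: J_posdef.
Qed.

(** Apply the bilinear bound to J u and u, then cancel one factor |J u|. *)
Lemma posdefmx_norm_le u : norm2 (J *m u) <= lM * norm2 u.
Proof.
have [->|n0] := eqVneq (norm2 (J *m u)) 0.
  by rewrite mulr_ge0 ?norm2_ge0 ?ltW // posdefmx_eigenvalue_gt0.
have n_gt0 : 0 < norm2 (J *m u) by rewrite lt_neqAle eq_sym n0 norm2_ge0.
rewrite -(ler_pM2l n_gt0) mulrCA -expr2 norm2_sqr.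
exact: le_trans (ler_norm _) (posdefmx_dot_le _ _).
Qed.

Lemma posdefmx_norm_ge u : eigenvalue J lm ->
  (forall a, eigenvalue J a -> lm <= a) -> lm * norm2 u <= norm2 (J *m u).
Proof.
move=> elm lm_min; have [->|n0] := eqVneq (norm2 u) 0.
  by rewrite mulr0 norm2_ge0.
have n_gt0 : 0 < norm2 u by rewrite lt_neqAle eq_sym n0 norm2_ge0.
rewrite -(ler_pM2l n_gt0) mulrCA -expr2 norm2_sqr.
apply: le_trans (rayleigh_ge J_posdef.1 lm_min u) _.
exact: le_trans (ler_norm _) (CauchySchwarz _ _).
Qed.

End Posdef.

(** * Identities for 3 by 3 matrices, hat, vee and cross products *)

Section Matrix3.
Variable K : realType.
Implicit Types (A J : 'M[K]_3) (u v w x y : 'cV[K]_3).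

Lemma ord3P (i : 'I_3) : [\/ i = 0, i = 1 | i = 2].
Proof.
by case: i => -[|[|[|//]]] p;
  [apply: Or31 | apply: Or32 | apply: Or33]; exact/val_inj.
Qed.

Lemma sum3 (V : nmodType) (F : 'I_3 -> V) : \sum_i F i = F 0 + F 1 + F 2.
Proof.
rewrite !big_ord_recl big_ord0 addr0 addrA.
by congr (F _ + F _ + F _); exact/val_inj.
Qed.

Lemma det3 A : \det A =
  A 0 0 * (A 1 1 * A 2 2 - A 1 2 * A 2 1)
  - A 0 1 * (A 1 0 * A 2 2 - A 1 2 * A 2 0)
  + A 0 2 * (A 1 0 * A 2 1 - A 1 1 * A 2 0).
Proof.
(* Going through [inord] indexes the entries by natural numbers, so that different presentations of
   the same ordinal become one atom for [ring]. *)
pose f a b := A (inord a) (inord b).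
have E i j : A i j = f i j by rewrite /f !inord_val.
rewrite (expand_det_row _ 0) sum3 /cofactor !(expand_det_row _ 0).
rewrite !big_ord_recl !big_ord0 /cofactor !det_mx11 !mxE !E /= /bump /=.
have -> : (1 %% 3 = 1)%N by [].
have -> : ((1 + 1) %% 3 = 2)%N by [].
by rewrite !(addn0, add0n) !addnS /= !exprS !expr0; ring.
Qed.

Ltac mx3 := apply/matrixP;
  let i := fresh in let j := fresh in
  move=> i j; rewrite /mxtrace !(mxE, sum3, det3); case: (ord3P i) => ->;
  (case: (ord3P j) => -> || rewrite ?ord1 => {j});
  rewrite /=; (ring || by field).

(** This is det [A u, A x, A y] = det A det [u, x, y], the triple product being u . hat(x) y. *)
Lemma hat_congr A x : A^T *m hat (A *m x) *m A = \det A *: hat x.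
Proof. mx3. Qed.

(** The sum of the principal 2 by 2 minors is written through traces, so that on rotations the
    identity can be solved for tr (Q Q). *)
Lemma Cayley_Hamilton3 A :
  A *m A *m A - \tr A *: (A *m A)
  + (2^-1 * (\tr A ^+ 2 - \tr (A *m A))) *: A - (\det A)%:M = 0.
Proof.
mx3.
Qed.

(** With A = Q and w = e_Omega this is twice the derivative of e_R; [trace_mul_hat] plays the same
    part for Psi. *)
Lemma vee_mul_hat A w :
  vee (A *m hat w - (A *m hat w)^T) = (\tr A)%:M *m w - A^T *m w.
Proof. mx3. Qed.

Lemma trace_mul_hat A w : \tr (A *m hat w) = - dot (vee (A - A^T)) w.
Proof. rewrite /mxtrace /dot !(mxE, sum3) /=; ring. Qed.

Lemma dot_vee_sub_tr A :
  dot (vee (A - A^T)) (vee (A - A^T)) = \tr (A^T *m A) - \tr (A *m A).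
Proof. rewrite /mxtrace /dot !(mxE, sum3) /=; ring. Qed.

Lemma trmx_hat x : (hat x)^T = - hat x.
Proof. mx3. Qed.

Lemma hatB x y : hat (x - y) = hat x - hat y.
Proof. mx3. Qed.

(** Origin of the matrix 2 J - tr J. Here e = e_Omega and e + a = Omega; the three terms come from
    the feedforward moment, the gyroscopic torque and the derivative of a. For symmetric J, tr J (e
    x a) = J e x a + e x J a + J (e x a), which eliminates J (e x a). *)
Lemma cross_inertia J e a : J^T = J ->
  cross a (J *m a) - cross (e + a) (J *m (e + a)) + J *m cross e a
  = cross (J *m e + (2 *: J - (\tr J)%:M) *m a) e.
Proof.
move=> sJ; have sE i j : J i j = J j i by rewrite -[in LHS]sJ mxE.
apply/matrixP => i j; rewrite ord1 /mxtrace !(mxE, sum3).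
by case: (ord3P i) => ->; rewrite /= (sE 1 0) (sE 2 0) (sE 2 1); ring.
Qed.

Lemma dot_cross_r x y : dot y (cross x y) = 0.
Proof. rewrite /dot !(mxE, sum3) /=; ring. Qed.

(** Lagrange's identity: the squares of the two sides differ by (x . y)^2. *)
Lemma norm2_cross x y : norm2 (cross x y) <= norm2 x * norm2 y.
Proof.
rewrite norm2_le ?mulr_ge0 ?norm2_ge0 // exprMn !norm2_sqr -subr_ge0.
suff -> : dot x x * dot y y - dot (cross x y) (cross x y) = dot x y ^+ 2.
  exact: sqr_ge0.
rewrite /dot !(mxE, sum3) /=; ring.
Qed.

End Matrix3.

(** * Traces of rotations and bounds on the attitude error *)

Section Rotations.
Variable K : realType.
Implicit Types (Q Rd R : 'M[K]_3) (u v w : 'cV[K]_3).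

Lemma mxtraceB n (A B : 'M[K]_n) : \tr (A - B) = \tr A - \tr B.
Proof. exact: linearB. Qed.

Lemma SO3_trmx Q : SO3 Q -> SO3 Q^T.
Proof. by case=> /mulmx1C QQ dQ; split; rewrite ?trmxK ?det_tr. Qed.

Lemma SO3_mulmx Rd R : SO3 Rd -> SO3 R -> SO3 (Rd *m R).
Proof.
move=> [RRd dRd] [RR dR]; split; last by rewrite det_mulmx dRd dR mulr1.
by rewrite trmx_mul -mulmxA (mulmxA Rd^T) RRd mul1mx.
Qed.

Lemma norm2_SO3 Q u : SO3 Q -> norm2 (Q *m u) = norm2 u.
Proof.
move=> [QQ _]; apply/eqP; rewrite -(@eqrXn2 _ 2) ?norm2_ge0 // !norm2_sqr.
by rewrite dot_mulmx mulmxA QQ mul1mx.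
Qed.

Lemma hat_mulmx_SO3 Q w : SO3 Q -> hat w *m Q = Q *m hat (Q^T *m w).
Proof.
move=> [QQ dQ]; have QQT : Q *m Q^T = 1%:M by apply: mulmx1C.
have := hat_congr Q (Q^T *m w); rewrite mulmxA QQT mul1mx dQ scale1r => <-.
by rewrite !mulmxA QQT mul1mx.
Qed.

(** Multiplying Cayley-Hamilton by Q^T, the inverse of Q, and taking the trace leaves an equation
    linear in tr (Q Q). *)
Lemma mxtrace_SO3_sqr Q : SO3 Q -> \tr (Q *m Q) = \tr Q ^+ 2 - 2 * \tr Q.
Proof.
move=> [QQ dQ]; have QQT : Q *m Q^T = 1%:M by apply: mulmx1C.
have := congr1 (fun A => \tr (A *m Q^T)) (Cayley_Hamilton3 Q).
rewrite dQ mul0mx mxtrace0 mulmxBl mulmxDl mulmxBl -!scalemxAl.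
rewrite -!(mulmxA _ Q Q^T) QQT !mulmx1 mul1mx.
by rewrite !mxtraceB mxtraceD mxtraceB !mxtraceZ mxtrace_tr mxtrace1; lra.
Qed.

Lemma SO3_quadratic Q : SO3 Q ->
  Q *m Q = \tr Q *: Q - (\tr Q)%:M + Q^T.
Proof.
move=> sQ; have [QQ dQ] := sQ; have QQT : Q *m Q^T = 1%:M by apply: mulmx1C.
have := congr1 (mulmx^~ Q^T) (Cayley_Hamilton3 Q).
rewrite dQ mul0mx mulmxBl mulmxDl mulmxBl -!scalemxAl.
rewrite -!(mulmxA _ Q Q^T) QQT !mulmx1 mul1mx mxtrace_SO3_sqr //.
have -> : 2^-1 * (\tr Q ^+ 2 - (\tr Q ^+ 2 - 2 * \tr Q)) = \tr Q by field.
rewrite scalemx1 => /eqP; rewrite subr_eq0 => /eqP <-.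
rewrite [RHS]addrC -(addrA (Q *m Q)) [_ + (\tr Q)%:M]addrC.
by rewrite -(opprB (\tr Q)%:M) addrK.
Qed.

Lemma dot_SO3_le Q u : SO3 Q -> dot u (Q *m u) <= dot u u.
Proof.
move=> sQ; apply: le_trans (ler_norm _) _.
by apply: le_trans (CauchySchwarz _ _) _; rewrite norm2_SO3 // -expr2 norm2_sqr.
Qed.

(* Q + Q^T + (1 - tr Q) I is (3 - tr Q) times the orthogonal projection onto
   the axis of the rotation Q. *)
Lemma SO3_axis Q w : SO3 Q ->
  let N := Q *m w + Q^T *m w + (1 - \tr Q) *: w in
  dot N N = (3 - \tr Q) * (2 * dot w (Q *m w) + (1 - \tr Q) * dot w w).
Proof.
move=> sQ N; have [QQ _] := sQ; have QQT := mulmx1C QQ.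
have qE : dot w (Q *m (Q *m w)) = \tr Q * dot w (Q *m w)
    - \tr Q * dot w w + dot w (Q *m w).
  rewrite mulmxA (SO3_quadratic sQ) mulmxDl mulmxBl -scalemxAl mul_scalar_mx.
  by rewrite !dotlin (dot_mulmx Q^T) trmxK (dotC (Q *m w)).
have e1 : dot (Q *m w) (Q *m w) = dot w w by rewrite dot_mulmx mulmxA QQ mul1mx.
have e2 : dot (Q^T *m w) (Q^T *m w) = dot w w.
  by rewrite dot_mulmx trmxK mulmxA QQT mul1mx.
have e3 : dot (Q *m w) (Q^T *m w) = dot w (Q *m (Q *m w)).
  by rewrite dot_mulmx trmxK dotC.
have e4 : dot (Q^T *m w) w = dot w (Q *m w) by rewrite dot_mulmx.
rewrite /N !dotlin (dotC (Q^T *m w) (Q *m w)) e1 e2 e3 qE e4.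
by rewrite (dotC (Q *m w) w) (dotC w (Q^T *m w)) e4; ring.
Qed.

Lemma mxtrace_SO3_le3 Q : SO3 Q -> \tr Q <= 3.
Proof.
move=> sQ; have h i : Q i i <= 1.
  have := dot_SO3_le (delta_mx i 0) sQ.
  by rewrite !dotE trmx_delta -!rowE -colE !mxE !eqxx.
by rewrite /mxtrace sum3; have := h 0; have := h 1; have := h 2; lra.
Qed.

(** The squared length of vee (Q - Q^T) is (3 - t) (1 + t) with t = tr Q. *)
Lemma mxtrace_SO3_geN1 Q : SO3 Q -> -1 <= \tr Q.
Proof.
move=> sQ; have := dot_ge0 (vee (Q - Q^T)); have [QQ _] := sQ.
rewrite dot_vee_sub_tr QQ mxtrace1 mxtrace_SO3_sqr //.
by have := mxtrace_SO3_le3 sQ; nra.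
Qed.

Lemma att_fun_ge0 Rd R : SO3 Rd -> SO3 R -> 0 <= att_fun Rd R.
Proof.
move=> sRd sR; have := mxtrace_SO3_le3 (SO3_mulmx (SO3_trmx sRd) sR).
by rewrite /att_fun mxtraceB mxtrace1; lra.
Qed.

Lemma err_R_sqr Rd R : SO3 Rd -> SO3 R ->
  norm2 (err_R Rd R) ^+ 2 = att_fun Rd R * (2 - att_fun Rd R).
Proof.
move=> sRd sR; have sQ := SO3_mulmx (SO3_trmx sRd) sR.
have [QQ _] := sQ; rewrite norm2_sqr /err_R /att_fun.
have -> : R^T *m Rd = (Rd^T *m R)^T by rewrite trmx_mul trmxK.
rewrite !dotlin dot_vee_sub_tr QQ (mxtrace_SO3_sqr sQ) mxtraceB mxtrace1.
by field.
Qed.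

Lemma norm2_err_R_le1 Rd R : SO3 Rd -> SO3 R -> norm2 (err_R Rd R) <= 1.
Proof.
move=> sRd sR; rewrite -(@ler_pXn2r _ 2) ?nnegrE ?norm2_ge0 // err_R_sqr //.
by have := sqr_ge0 (att_fun Rd R - 1); lra.
Qed.

(** For w = e_Omega the vector on the left is de_R/dt. The proof rests on 2 w . Q w + (1 - tr Q)
    |w|^2 >= 0: by [SO3_axis] its product with 3 - tr Q is a square, and at tr Q = 3 it vanishes
    because N does. *)
Lemma norm2_trace_sub_SO3 Q w : SO3 Q ->
  norm2 (2^-1 *: ((\tr Q)%:M *m w - Q^T *m w)) <= norm2 w.
Proof.
move=> sQ; have [QQ _] := sQ; have QQT := mulmx1C QQ.
rewrite norm2_le ?norm2_ge0 // norm2_sqr mul_scalar_mx !dotlin.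
have e2 : dot (Q^T *m w) (Q^T *m w) = dot w w.
  by rewrite dot_mulmx trmxK mulmxA QQT mul1mx.
have e4 : dot (Q^T *m w) w = dot w (Q *m w) by rewrite dot_mulmx.
rewrite e2 (dotC w (Q^T *m w)) e4.
have := SO3_axis w sQ; set N := _ + _ + _ => /= NE.
have t3 := mxtrace_SO3_le3 sQ; have q1 := dot_SO3_le w sQ.
have q0 : 0 <= 2 * dot w (Q *m w) + (1 - \tr Q) * dot w w.
  have [t3'|t3'] := ltP (\tr Q) 3.
    by have := dot_ge0 N; rewrite NE pmulr_rge0 // subr_gt0.
  have tE : \tr Q = 3 by apply/eqP; rewrite eq_le t3 t3'.
  have N0 : N = 0 by apply: dot_eq0; rewrite NE tE subrr mul0r.
  have : dot w N = 0 by rewrite N0 -(scale0r (0 : 'cV[K]_3)) dotZr mul0r.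
  by rewrite /N !dotlin (dotC w (Q^T *m w)) e4; lra.
have w0 := dot_ge0 w; set q := dot w (Q *m w) in q0 q1 *.
set W := dot w w in q0 q1 w0 *; set t := \tr Q in q0 t3 *.
(* Four times the difference of the squared norms. For t >= 0 both summands are nonnegative; for t <
   0 it is regrouped as (1 + t) (3 - t) W - 2 t (W - q), where -1 <= t and q <= W apply. *)
suff : 0 <= (3 - t) * W + t * (2 * q + (1 - t) * W) by lra.
have [t0|t0] := leP 0 t; first by rewrite addr_ge0 // mulr_ge0 // subr_ge0.
have tN1 : -1 <= t by exact: mxtrace_SO3_geN1.
have : 0 <= (1 + t) * ((3 - t) * W) by rewrite !mulr_ge0 //; lra.
have : 0 <= - t * (2 * (W - q)) by rewrite !mulr_ge0 //; lra.
lra.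
Qed.

End Rotations.

(** * Derivatives and limits of matrix-valued functions; Barbalat's argument *)

Section MatrixCalculus.
Variable K : realType.
Implicit Types t : K.

Lemma cvg_mxP (T : Type) (F : set_system T) (m n : nat)
    (f : T -> 'M[K]_(m, n)) (L : 'M[K]_(m, n)) : Filter F ->
  (f x @[x --> F] --> L) <->
  (forall i j, f x i j @[x --> F] --> L i j).
Proof.
move=> FF; split=> [fL i j|fL].
  exact: (cvg_comp _ _ fL (@coord_continuous K m n i j L)).
apply/cvgrPdist_le => /= e e0; near=> x.
rewrite /Num.Def.normr/= mx_normrE (bigmax_le _ (ltW e0))//= => i _.
rewrite !mxE/=; move: i; near: x; apply: filter_forall => /= i.
exact: ((cvgrPdist_le _ _).1 (fL i.1 i.2)).
Unshelve. all: by end_near. Qed.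

Lemma is_derive_mxP (m n : nat) (M : K -> 'M[K]_(m, n)) (D : 'M[K]_(m, n)) t :
  is_derive t 1 M D <->
  (forall i j, is_derive t 1 (fun s => M s i j) (D i j)).
Proof.
split=> [[dM <-] i j|dM].
  rewrite derive_mx // mxE; apply: derivableP.
  exact: (derivable_mxP _ _ _).1.
have dM' : derivable M t 1 by apply/derivable_mxP => i j; case: (dM i j).
split=> //; rewrite derive_mx //; apply/matrixP => i j; rewrite mxE.
exact: derive_val.
Qed.

Lemma is_derive1_derive (V : normedModType K) (f : K -> V) t :
  derivable f t 1 -> is_derive t 1 f (derive1 f t).
Proof. by rewrite derive1E; exact: derivableP. Qed.

Section Pointwise.
Variable V : normedModType K.

Lemma is_derive_add (f g : K -> V) df dg t : is_derive t 1 f df ->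
  is_derive t 1 g dg -> is_derive t 1 (fun s => f s + g s) (df + dg).
Proof. exact: is_deriveD. Qed.

Lemma is_derive_opp (f : K -> V) df t : is_derive t 1 f df ->
  is_derive t 1 (fun s => - f s) (- df).
Proof. exact: is_deriveN. Qed.

Lemma is_derive_scale a (f : K -> V) df t : is_derive t 1 f df ->
  is_derive t 1 (fun s => a *: f s) (a *: df).
Proof. exact: is_deriveZ. Qed.

Lemma is_derive_mul (f g : K -> K) df dg t : is_derive t 1 f df ->
  is_derive t 1 g dg ->
  is_derive t 1 (fun s => f s * g s) (df * g t + f t * dg).
Proof.
move=> hf hg; have h := is_deriveM hf hg.
have -> : df * g t + f t * dg = f t *: dg + g t *: df.
  by rewrite addrC (mulrC df).
exact: h.
Qed.

End Pointwise.

Lemma is_derive_bigsum n (h : 'I_n -> K -> K) dh t :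
  (forall i, is_derive t 1 (h i) (dh i)) ->
  is_derive t 1 (fun s => \sum_i h i s) (\sum_i dh i).
Proof.
move=> hh; have := is_derive_sum hh.
by congr is_derive; apply/funext => s; rewrite fct_sumE.
Qed.

Lemma is_derive_mulmx m n p (A : K -> 'M[K]_(m, n)) (B : K -> 'M[K]_(n, p))
    dA dB t : is_derive t 1 A dA -> is_derive t 1 B dB ->
  is_derive t 1 (fun s => A s *m B s) (dA *m B t + A t *m dB).
Proof.
move=> /is_derive_mxP hA /is_derive_mxP hB; apply/is_derive_mxP => i j.
rewrite !mxE -big_split /=; under eq_fun do rewrite mxE.
by apply: is_derive_bigsum => k; apply: is_derive_mul.
Qed.

Lemma is_derive_trmx m n (A : K -> 'M[K]_(m, n)) dA t :
  is_derive t 1 A dA -> is_derive t 1 (fun s => (A s)^T) dA^T.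
Proof.
move=> /is_derive_mxP hA; apply/is_derive_mxP => i j.
by rewrite mxE; under eq_fun do rewrite mxE.
Qed.

Lemma is_derive_mulmxl m n p (A : 'M[K]_(m, n)) (B : K -> 'M[K]_(n, p)) dB t :
  is_derive t 1 B dB -> is_derive t 1 (fun s => A *m B s) (A *m dB).
Proof.
move=> hB; apply: is_derive_eq.
  exact: (is_derive_mulmx (is_derive_cst A t 1) hB).
by rewrite mul0mx add0r.
Qed.

Lemma is_derive_mxtrace n (A : K -> 'M[K]_n) dA t :
  is_derive t 1 A dA -> is_derive t 1 (fun s => \tr (A s)) (\tr dA).
Proof. by move=> /is_derive_mxP hA; apply: is_derive_bigsum. Qed.

Lemma is_derive_dot n (u v : K -> 'cV[K]_n) du dv t :
  is_derive t 1 u du -> is_derive t 1 v dv ->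
  is_derive t 1 (fun s => dot (u s) (v s)) (dot du (v t) + dot (u t) dv).
Proof.
move=> /is_derive_mxP hu /is_derive_mxP hv.
rewrite /dot -big_split /=.
by apply: is_derive_bigsum => k; apply: is_derive_mul.
Qed.

Lemma is_derive_vee (A : K -> 'M[K]_3) dA t :
  is_derive t 1 A dA -> is_derive t 1 (fun s => vee (A s)) (vee dA).
Proof.
move=> /is_derive_mxP hA; apply/is_derive_mxP => i j.
rewrite !mxE; under eq_fun do rewrite mxE.
by case: (ord3P i) => -> /=.
Qed.

Lemma cvg_bigsum (T : Type) (F : set_system T) n (h : 'I_n -> T -> K)
    (l : 'I_n -> K) : Filter F -> (forall i, h i x @[x --> F] --> l i) ->
  \sum_i h i x @[x --> F] --> \sum_i l i.
Proof.
move=> FF hl; apply: (@cvg_big _ _ _ _ xpredT (@add_continuous K)) => i _.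
exact: hl.
Qed.

Lemma cvg_dot (T : Type) (F : set_system T) n (u v : T -> 'cV[K]_n) lu lv :
  Filter F -> u x @[x --> F] --> lu -> v x @[x --> F] --> lv ->
  dot (u x) (v x) @[x --> F] --> dot lu lv.
Proof.
move=> FF /cvg_mxP hu /cvg_mxP hv; apply: cvg_bigsum => i.
by apply: cvgM; [exact: hu|exact: hv].
Qed.

Lemma cvg_mulmx (T : Type) (F : set_system T) m n p
    (A : T -> 'M[K]_(m, n)) (B : T -> 'M[K]_(n, p))
    (lA : 'M[K]_(m, n)) (lB : 'M[K]_(n, p)) :
  Filter F -> A x @[x --> F] --> lA -> B x @[x --> F] --> lB ->
  A x *m B x @[x --> F] --> lA *m lB.
Proof.
move=> FF /cvg_mxP hA /cvg_mxP hB; apply/cvg_mxP => i j.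
rewrite mxE; under eq_fun do rewrite mxE.
by apply: cvg_bigsum => k; apply: cvgM; [exact: hA|exact: hB].
Qed.

Lemma cvg_trmx (T : Type) (F : set_system T) m n
    (A : T -> 'M[K]_(m, n)) (lA : 'M[K]_(m, n)) :
  Filter F -> A x @[x --> F] --> lA -> (A x)^T @[x --> F] --> lA^T.
Proof.
move=> FF /cvg_mxP hA; apply/cvg_mxP => i j.
by rewrite mxE; under eq_fun do rewrite mxE; exact: hA.
Qed.

Lemma cvg_mxtrace (T : Type) (F : set_system T) n
    (A : T -> 'M[K]_n) (lA : 'M[K]_n) :
  Filter F -> A x @[x --> F] --> lA -> \tr (A x) @[x --> F] --> \tr lA.
Proof.
by move=> FF /cvg_mxP hA; apply: cvg_bigsum => i; exact: hA.
Qed.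

Lemma cvg_vee (T : Type) (F : set_system T) (A : T -> 'M[K]_3)
    (lA : 'M[K]_3) :
  Filter F -> A x @[x --> F] --> lA -> vee (A x) @[x --> F] --> vee lA.
Proof.
move=> FF /cvg_mxP hA; apply/cvg_mxP => i j.
by rewrite mxE; under eq_fun do rewrite mxE; case: (ord3P i) => ->; exact: hA.
Qed.

Lemma cvg_norm2_sqr0 (T : Type) (F : set_system T) n (u : T -> 'cV[K]_n) :
  Filter F -> norm2 (u x) ^+ 2 @[x --> F] --> (0 : K) ->
  u x @[x --> F] --> (0 : 'cV[K]_n).
Proof.
move=> FF u0; apply/cvg_mxP => i j; rewrite mxE (ord1 j).
apply/cvgrPdist_le => e e0.
have e20 : 0 < e ^+ 2 by rewrite exprn_gt0.
move/cvgrPdist_le : u0 => /(_ _ e20); apply: filterS => x.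
rewrite sub0r normrN ger0_norm ?sqr_ge0 // norm2_sqr => h.
rewrite sub0r normrN -(@ler_pXn2r _ 2) ?nnegrE ?(ltW e0) //.
rewrite real_normK ?num_real //; apply: le_trans _ h.
rewrite /dot (bigD1 i) //= -expr2 lerDl; apply: sumr_ge0 => k _.
by rewrite -expr2 sqr_ge0.
Qed.

(* Beyond some time V decreases by less than any prescribed amount, whereas a
   value n t >= e forces n >= e / 2, hence a fixed decrease of V, on a time
   interval whose length depends only on e and L. *)
Lemma barbalat (V n dV dn : K -> K) (t0 al L : K) :
  0 < al ->
  (forall t, t0 < t -> is_derive t 1 V (dV t)) ->
  (forall t, t0 < t -> is_derive t 1 n (dn t)) ->
  (forall t, t0 < t -> 0 <= V t) ->
  (forall t, t0 < t -> 0 <= n t) ->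
  (forall t, t0 < t -> dV t <= - (al * n t)) ->
  (forall t, t0 < t -> `|dn t| <= L) ->
  n t @[t --> +oo] --> (0 : K).
Proof.
move=> al0 hV hn V0 n0 hdV hdn.
have L0 : 0 <= L by apply: le_trans (hdn (t0 + 1) _); rewrite ?ltrDl.
have mvt (f df : K -> K) a b : t0 < a -> a <= b ->
    (forall t, t0 < t -> is_derive t 1 f (df t)) ->
    exists2 c, a <= c <= b & f b - f a = df c * (b - a).
  move=> ta ab hf; have h c : a <= c -> t0 < c by apply: lt_le_trans.
  have [||c] := @MVT_segment _ f df a b ab.
  - by move=> c; rewrite in_itv /= => /andP[/ltW ac _]; exact/hf/h.
  - apply: derivable_within_continuous => c; rewrite in_itv /= => /andP[ac _].
    by case: (hf c (h c ac)).
  - by rewrite in_itv /=; exists c.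
apply/cvgrPdist_lt => e e0.
(* A slope of at most L loses at most e / 2 in time h; L + 1 avoids dividing by zero. [gap] is the
   decrease of V over that time. *)
pose h := e / (2 * (L + 1)); pose gap := al * (e / 2) * h.
have h0 : 0 < h by rewrite divr_gt0 // mulr_gt0 // ltr_wpDl.
have e20 : 0 < e / 2 by rewrite divr_gt0.
have gap0 : 0 < gap by apply: mulr_gt0 h0; exact: mulr_gt0.
pose S := [set V t | t in [set t | t0 < t]].
have infS : has_inf S.
  split; first by exists (V (t0 + 1)), (t0 + 1) => //=; rewrite ltrDl.
  by exists 0 => _ [t /= tt <-]; exact: V0.
(* From T on, V is within [gap] of its infimum, so a further decrease by [gap] is contradictory. *)
have [_ [T /= t0T <-] VT] := inf_adherent gap0 infS.
near=> t.
have Tt : T <= t by near: t; exact: nbhs_pinfty_ge (num_real T).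
have t0t : t0 < t := lt_le_trans t0T Tt.
rewrite sub0r normrN ger0_norm ?n0 // ltNge; apply/negP => en.
have ths : t <= t + h by rewrite lerDl ltW.
have Vt : V t <= V T.
  have [c /andP[Tc _] VE] := mvt V dV T t t0T Tt hV.
  have t0c := lt_le_trans t0T Tc.
  rewrite -subr_le0 VE mulr_le0_ge0 ?subr_ge0 //.
  by rewrite (le_trans (hdV c t0c)) // oppr_le0 mulr_ge0 ?n0 // ltW.
have ns s : t <= s -> s <= t + h -> e / 2 <= n s.
  move=> ts sh; have [c /andP[tc _] nE] := mvt n dn t s t0t ts hn.
  have : `|n s - n t| <= L * h.
    rewrite nE normrM ler_pM ?hdn ?(lt_le_trans t0t) //.
    by rewrite ger0_norm ?subr_ge0 // lerBlDl.
  have : L * h <= e / 2.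
    have -> : L * h = L / (L + 1) * (e / 2).
      by rewrite /h; field; rewrite gt_eqF // ltr_wpDl.
    rewrite ger_pMl // ler_pdivrMr ?mul1r ?lerDl //.
    by rewrite ltr_wpDl.
  by rewrite ler_distl => h1 /andP[h2 _]; lra.
have [c /andP[tc ch] VE] := mvt V dV t (t + h) t0t ths hV.
have t0c := lt_le_trans t0t tc.
have : V (t + h) <= V T - gap.
  move: VE; rewrite (addrC t) addrK => VE.
  have : dV c * h <= - gap.
    rewrite /gap -mulNr ler_pM2r // (le_trans (hdV c t0c)) // lerN2.
    by rewrite ler_pM2l // ns.
  by move: Vt VE; lra.
have : inf S <= V (t + h).
  apply: ge_inf; first by case: infS.
  by exists (t + h) => //=; exact: lt_le_trans t0t ths.
by move: VT; lra.
Unshelve. all: by end_near. Qed.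

End MatrixCalculus.

(* The terms in th cancel: this is what dictates the adaptive law. *)
Lemma lyapunov_rate (K : realType) (P : nat) (J : 'M[K]_3) (kR kO c2 gam : K)
    (e de r dr z : 'cV[K]_3) (A : 'M[K]_(3, P)) (th : 'cV[K]_P) :
  let dth := - (gam *: (A^T *m (e + c2 *: r))) in
  J^T = J -> gam != 0 ->
  J *m de = cross z e - kR *: r - kO *: e + A *m th ->
  2^-1 * (dot de (J *m e) + dot e (J *m de)) + kR * dot r e
  + c2 * (dot dr (J *m e) + dot r (J *m de))
  + (2 * gam)^-1 * (dot dth th + dot th dth)
  = - kO * dot e e - c2 * kR * dot r r - c2 * kO * dot r e
    + c2 * dot r (cross z e) + c2 * dot dr (J *m e).
Proof.
move=> dth sJ gam0 JdeE; have -> : dot de (J *m e) = dot e (J *m de).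
  by rewrite dot_mulmx sJ dotC.
have adj u : dot th (A^T *m u) = dot u (A *m th).
  by rewrite dot_mulmx trmxK dotC.
rewrite (dotC dth) /dth !dotNr !dotZr !adj JdeE !dotlin dot_cross_r.
by rewrite (dotC e r); field.
Qed.

(** * Error dynamics and the Lyapunov function along a solution *)

Section ClosedLoop.
Variables (K : realType) (P : nat) (m g : K) (J : 'M[K]_3) (lm lM : K).
Variables (Wx WR : 'cV[K]_3 -> 'cV[K]_3 -> 'M[K]_3 -> 'cV[K]_3 -> 'M[K]_(3, P)).
Variables (thx thR : 'cV[K]_P) (Rd : K -> 'M[K]_3) (Omd : K -> 'cV[K]_3).
Variables (kR kO c2 gamR B2 al : K).
Implicit Types t : K.
Hypothesis J_posdef : posdefmx J.
Hypothesis lM_eigen : eigenvalue J lM.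
Hypothesis lM_max : forall a, eigenvalue J a -> a <= lM.
Hypothesis Rd_smooth : forall (n : nat) (t : K), derivable (derive1n n Rd) t 1.
Hypothesis Rd_SO3 : forall t, 0 <= t -> SO3 (Rd t).
Hypothesis Rd_kinematics :
  forall t, 0 <= t -> derive1 Rd t = Rd t *m hat (Omd t).
Hypothesis gamR_gt0 : 0 < gamR.
Hypothesis c2_gt0 : 0 < c2.
Hypothesis kO_gt0 : 0 < kO.
Hypothesis B2_bound : forall t, 0 <= t ->
  mxnorm2 (2 *: J - (\tr J)%:M) * norm2 (Omd t) <= B2.

Let lM_gt0 : 0 < lM := posdefmx_eigenvalue_gt0 J_posdef lM_eigen.

(** Through this formula Omega_d inherits its regularity from R_d. It holds for nonnegative times,
    hence derivability at positive times and one-sided continuity at 0. *)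
Lemma Omd_vee t : 0 <= t -> Omd t = vee ((Rd t)^T *m derive1 Rd t).
Proof.
move=> t0; rewrite Rd_kinematics // mulmxA.
by have [-> _] := Rd_SO3 t0; rewrite mul1mx hatK.
Qed.

Lemma derivable_Rd t : derivable Rd t 1.
Proof. exact: (@Rd_smooth 0%N t). Qed.

Lemma derivable_derive1_Rd t : derivable (derive1 Rd) t 1.
Proof. exact: (@Rd_smooth 1%N t). Qed.

Lemma derivable_Omd t : 0 < t -> derivable Omd t 1.
Proof.
move=> t0.
have hvee : is_derive t 1 (fun s => vee ((Rd s)^T *m derive1 Rd s))
    (vee ((derive1 Rd t)^T *m derive1 Rd t
          + (Rd t)^T *m derive1 (derive1 Rd) t)).
  apply: is_derive_vee; apply: is_derive_mulmx.
    by apply/is_derive_trmx/is_derive1_derive; exact: derivable_Rd.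
  by apply: is_derive1_derive; exact: derivable_derive1_Rd.
have : derivable (fun s => vee ((Rd s)^T *m derive1 Rd s)) t 1 by case: hvee.
apply: near_eq_derivable; near=> s; rewrite -Omd_vee //.
by near: s; apply: filterS (lt_nbhsr t0) => s /ltW.
Unshelve. all: by end_near. Qed.

Variables (t0 : K) (T : \bar K) (f : K -> K) (x v : K -> 'cV[K]_3).
Variables (R : K -> 'M[K]_3) (Om : K -> 'cV[K]_3) (thb : K -> 'cV[K]_P).
Hypothesis t0_ge0 : 0 <= t0.
Hypothesis loop :
  closed_loop m g J Wx WR thx thR kR kO c2 gamR Rd Omd t0 T f x v R Om thb.

Let Q t := (Rd t)^T *m R t.
Let eR t := err_R (Rd t) (R t).
Let eO t := err_Omega (Rd t) (R t) (Omd t) (Om t).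
Let W t := WR (x t) (v t) (R t) (Om t).
Let th t := thR - thb t.
Let a t := (Q t)^T *m Omd t.

Definition lyapunov t :=
  2^-1 * dot (eO t) (J *m eO t) + kR * att_fun (Rd t) (R t)
  + c2 * dot (eR t) (J *m eO t) + (2 * gamR)^-1 * dot (th t) (th t).

Lemma timespan_SO3 t :
  timespan t0 T t -> [/\ SO3 (Rd t), SO3 (R t) & SO3 (Q t)].
Proof.
move=> tT; have sRd : SO3 (Rd t) by apply: Rd_SO3; apply: le_trans tT.1.
have sR : SO3 (R t) := dyn_SO3 loop.1 tT.
by split=> //; exact: SO3_mulmx (SO3_trmx sRd) sR.
Qed.

Lemma eRE t : eR t = 2^-1 *: vee (Q t - (Q t)^T).
Proof. by rewrite /eR /err_R /Q trmx_mul trmxK. Qed.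

Lemma eOE t : eO t = Om t - a t.
Proof. by rewrite /eO /err_Omega /a /Q trmx_mul trmxK. Qed.

Lemma norm2_desired_inertia t : timespan t0 T t ->
  norm2 ((2 *: J - (\tr J)%:M) *m a t) <= B2.
Proof.
move=> tT; have [_ _ sQ] := timespan_SO3 tT.
apply: (le_trans (norm2_mulmx _ _)).
by rewrite norm2_SO3; [apply/B2_bound/(le_trans t0_ge0 tT.1)|exact: SO3_trmx].
Qed.

Section Derivatives.
Variable t : K.
Hypothesis tT : timespan t0 T t.
Hypothesis t0t : t0 < t.

Let deR := 2^-1 *: ((\tr (Q t))%:M *m eO t - (Q t)^T *m eO t).
Let d := (2 *: J - (\tr J)%:M) *m a t.

Lemma is_derive_Q : is_derive t 1 Q (Q t *m hat (eO t)).
Proof.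
have [_ _ sQ] := timespan_SO3 tT.
have [_ _ dR _] := dyn_derivable loop.1 tT t0t.
apply: is_derive_eq.
  apply: is_derive_mulmx.
    by apply/is_derive_trmx/is_derive1_derive; exact: derivable_Rd.
  exact: is_derive1_derive dR.
rewrite (dyn_R loop.1 tT t0t) Rd_kinematics ?(le_trans t0_ge0 tT.1) //.
(* Moving hat(Omega_d) to the right of Q turns it into hat(a), with a the desired velocity in the
   body frame, and Omega - a = e_Omega. *)
rewrite trmx_mul trmx_hat mulNmx mulNmx -mulmxA hat_mulmx_SO3 //.
by rewrite mulmxA -/(Q t) addrC -mulmxBr eOE hatB.
Qed.

Lemma is_derive_att_fun :
  is_derive t 1 (fun s => att_fun (Rd s) (R s)) (dot (eR t) (eO t)).
Proof.
have -> : dot (eR t) (eO t) = 2^-1 * \tr (- (Q t *m hat (eO t))).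
  by rewrite eRE dotZl linearN /= trace_mul_hat opprK.
apply: is_derive_scale; apply: is_derive_mxtrace.
rewrite -[X in is_derive _ _ _ X]add0r.
apply: is_derive_add.
by apply: is_derive_opp; exact: is_derive_Q.
Qed.

Lemma is_derive_eR : is_derive t 1 eR deR.
Proof.
rewrite (_ : eR = fun s => 2^-1 *: vee (Q s - (Q s)^T)); last first.
  by apply/funext => s; rewrite eRE.
rewrite /deR -vee_mul_hat; apply/is_derive_scale/is_derive_vee.
apply: is_derive_add; first exact: is_derive_Q.
by apply/is_derive_opp/is_derive_trmx; exact: is_derive_Q.
Qed.

Lemma norm2_deR : norm2 deR <= norm2 (eO t).
Proof. by have [_ _ sQ] := timespan_SO3 tT; exact: norm2_trace_sub_SO3. Qed.

Lemma is_derive_a :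
  is_derive t 1 a (- cross (eO t) (a t) + (Q t)^T *m derive1 Omd t).
Proof.
have tp : 0 < t by apply: le_lt_trans t0t.
apply: is_derive_eq.
  apply: is_derive_mulmx; first by apply: is_derive_trmx; exact: is_derive_Q.
  by apply: is_derive1_derive; exact: derivable_Omd.
by rewrite trmx_mul trmx_hat mulNmx mulNmx -mulmxA hat_mul.
Qed.

(** The dynamics determine de_Omega/dt through J only; J de_Omega/dt suffices both for dV/dt and, by
    the least eigenvalue of J, for bounding de_Omega/dt. *)
Lemma is_derive_eO : exists2 deO, is_derive t 1 eO deO &
  J *m deO = cross (J *m eO t + d) (eO t) - kR *: eR t - kO *: eO t
             + W t *m th t.
Proof.
have [_ _ _ dOm] := dyn_derivable loop.1 tT t0t.
exists (derive1 Om t - (- cross (eO t) (a t) + (Q t)^T *m derive1 Omd t)).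
  have eOf : (fun s => Om s - a s) = eO by apply/funext => s; rewrite eOE.
  rewrite -[X in is_derive _ _ X]eOf.
  apply: is_derive_add; first exact: is_derive1_derive.
  by apply: is_derive_opp; exact: is_derive_a.
have OmE : Om t = eO t + a t by rewrite eOE subrK.
have := dyn_Om loop.1 tT t0t; rewrite /= -/(W t) /control_moment.
rewrite -/(eR t) -/(eO t).
have -> : (R t)^T *m Rd t *m Omd t = a t by rewrite /a /Q trmx_mul trmxK.
rewrite -!mulmxA (mulmxA (R t)^T (Rd t) (Omd t)).
have -> : (R t)^T *m Rd t *m Omd t = a t by rewrite /a /Q trmx_mul trmxK.
rewrite (mulmxA (R t)^T (Rd t)).
have -> : (R t)^T *m Rd t = (Q t)^T by rewrite /Q trmx_mul trmxK.
rewrite hat_mul => dynE.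
rewrite mulmxBr mulmxDr mulmxN.
have -> : J *m derive1 Om t = - (kR *: eR t) - kO *: eO t - W t *m thb t
    + cross (a t) (J *m a t) + J *m ((Q t)^T *m derive1 Omd t)
    + W t *m thR - cross (Om t) (J *m Om t).
  by rewrite -dynE addrK.
rewrite -(cross_inertia _ _ J_posdef.1) -OmE /th mulmxBr.
by apply/matrixP => i j; rewrite !mxE; ring.
Qed.

Lemma is_derive_th :
  is_derive t 1 th (- (gamR *: ((W t)^T *m (eO t + c2 *: eR t)))).
Proof.
rewrite -[X in is_derive _ _ _ X]add0r.
apply: is_derive_add.
apply: is_derive_opp; rewrite -(adapt_eq loop.2 tT t0t).
exact/is_derive1_derive/(adapt_derivable loop.2 tT t0t).
Qed.

Lemma is_derive_lyapunov : is_derive t 1 lyapunov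
  (- kO * dot (eO t) (eO t) - c2 * kR * dot (eR t) (eR t)
   - c2 * kO * dot (eR t) (eO t)
   + c2 * dot (eR t) (cross (J *m eO t + d) (eO t))
   + c2 * dot deR (J *m eO t)).
Proof.
have [deO hO JdeO] := is_derive_eO.
have hJ : is_derive t 1 (fun s => J *m eO s) (J *m deO).
  exact: is_derive_mulmxl.
apply: is_derive_eq.
  apply: is_derive_add.
    apply: is_derive_add.
      apply: is_derive_add.
        apply: (@is_derive_scale _ K^o); exact: (is_derive_dot hO hJ).
      by apply: (@is_derive_scale _ K^o); exact: is_derive_att_fun.
    by apply: (@is_derive_scale _ K^o); exact: (is_derive_dot is_derive_eR hJ).
  by apply: (@is_derive_scale _ K^o);
    exact: (is_derive_dot is_derive_th is_derive_th).
exact: lyapunov_rate J_posdef.1 (lt0r_neq0 gamR_gt0) JdeO.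
Qed.

Hypothesis decay : forall y z : K, al * (y ^+ 2 + z ^+ 2) <=
  c2 * kR * y ^+ 2 + (kO - 2 * c2 * lM) * z ^+ 2 - c2 * (kO + B2) * y * z.

(** In [decay], one c_2 lambda_M comes from the gyroscopic product with e_R and one from de_R/dt . J
    e_Omega; k_Omega and B_2 come from the damping term and from d, each paired with e_R. *)
Lemma derive1_lyapunov_le :
  derive1 lyapunov t <= - (al * (dot (eR t) (eR t) + dot (eO t) (eO t))).
Proof.
have hV := is_derive_lyapunov; rewrite derive1E derive_val.
have [sRd sR _] := timespan_SO3 tT.
rewrite -!norm2_sqr; have := decay (norm2 (eR t)) (norm2 (eO t)).
have y0 := norm2_ge0 (eR t); have z0 := norm2_ge0 (eO t).
have y1 : norm2 (eR t) <= 1 := norm2_err_R_le1 sRd sR.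
have h1 : - dot (eR t) (eO t) <= norm2 (eR t) * norm2 (eO t).
  by apply: le_trans (CauchySchwarz _ _); rewrite -normrN ler_norm.
have h2 : dot (eR t) (cross (J *m eO t + d) (eO t))
    <= lM * norm2 (eO t) ^+ 2 + B2 * norm2 (eR t) * norm2 (eO t).
  apply: (le_trans (ler_norm _)); apply: (le_trans (CauchySchwarz _ _)).
  have hJ : norm2 (J *m eO t) <= lM * norm2 (eO t) by exact: posdefmx_norm_le.
  have hd : norm2 (J *m eO t + d) <= lM * norm2 (eO t) + B2.
    by apply: (le_trans (norm2D _ _)); rewrite lerD // norm2_desired_inertia.
  have hc : norm2 (cross (J *m eO t + d) (eO t))
      <= (lM * norm2 (eO t) + B2) * norm2 (eO t).
    by apply: (le_trans (norm2_cross _ _)); rewrite ler_wpM2r.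
  apply: (@le_trans _ _
    (norm2 (eR t) * ((lM * norm2 (eO t) + B2) * norm2 (eO t)))).
    by rewrite ler_wpM2l.
  (* |e_R| <= 1 turns the cubic term into a quadratic one. *)
  have : 0 <= (1 - norm2 (eR t)) * (lM * norm2 (eO t) ^+ 2).
    by rewrite mulr_ge0 ?subr_ge0 // mulr_ge0 ?sqr_ge0 // ltW ?lM_gt0.
  by lra.
have h3 : dot deR (J *m eO t) <= lM * norm2 (eO t) ^+ 2.
  apply: (le_trans (ler_norm _)).
  apply: le_trans (posdefmx_dot_le J_posdef lM_eigen lM_max _ _) _.
  rewrite ler_wpM2l ?(ltW lM_gt0) // expr2.
  by rewrite ler_wpM2r // norm2_deR.
have k1 : 0 <= (c2 * kO) * (norm2 (eR t) * norm2 (eO t) + dot (eR t) (eO t)).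
  by rewrite mulr_ge0 ?(mulr_ge0 (ltW c2_gt0) (ltW kO_gt0)) //; lra.
move: h2 h3; rewrite -(ler_pM2l c2_gt0) => h2; rewrite -(ler_pM2l c2_gt0) => h3.
by move: k1 h2 h3; lra.
Qed.

End Derivatives.

(** Derivatives are available only after t0, so comparing V with its initial value by the mean value
    theorem requires continuity up to t0. *)
Lemma within_continuous_lyapunov t : timespan t0 T t ->
  {within `[t0, t], continuous lyapunov}.
Proof.
move=> tT.
have sub : `[t0, t] `<=` timespan t0 T.
  move=> s /=; rewrite in_itv /= => /andP[t0s st]; split=> //.
  by apply: le_lt_trans tT.2; rewrite lee_fin.
have cR := continuous_subspaceW sub (dyn_cont_R loop.1).
have cOm := continuous_subspaceW sub (dyn_cont_Om loop.1).
have cth := continuous_subspaceW sub (adapt_cont loop.2).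
have cts (V : normedModType K) (h : K -> V) : (forall s, derivable h s 1) ->
    {within `[t0, t], continuous h}.
  move=> dh; apply: continuous_subspaceT => s.
  exact/differentiable_continuous/derivable1_diffP.
have cRd := cts _ _ derivable_Rd; have cRd' := cts _ _ derivable_derive1_Rd.
have cOmd : {within `[t0, t], continuous Omd}.
  apply: (@subspace_eq_continuous _ _ _
    (fun s => vee ((Rd s)^T *m derive1 Rd s))).
    move=> s; rewrite inE /= in_itv /= => /andP[t0s _].
    by rewrite /from_subspace Omd_vee // (le_trans t0_ge0).
  move=> s; apply: cvg_vee; apply: cvg_mulmx; last exact: cRd'.
  by apply: cvg_trmx; exact: cRd.
have cQ : {within `[t0, t], continuous Q}.
  move=> s; apply: cvg_mulmx; last exact: cR.
  by apply: cvg_trmx; exact: cRd.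
have ceO : {within `[t0, t], continuous eO}.
  rewrite (_ : eO = fun s => Om s - a s); last first.
    by apply/funext => s; rewrite eOE.
  move=> s; apply: cvgB; first exact: cOm.
  by apply: cvg_mulmx; [apply: cvg_trmx; exact: cQ|exact: cOmd].
have ceR : {within `[t0, t], continuous eR}.
  rewrite (_ : eR = fun s => 2^-1 *: vee (Q s - (Q s)^T)); last first.
    by apply/funext => s; rewrite eRE.
  move=> s; apply: cvgZr; apply: cvg_vee; apply: cvgB; first exact: cQ.
  by apply: cvg_trmx; exact: cQ.
have cJ : {within `[t0, t], continuous (fun s => J *m eO s)}.
  by move=> s; apply: cvg_mulmx; [exact: cvg_cst|exact: ceO].
have cth' : {within `[t0, t], continuous th}.
  by move=> s; apply: cvgB; [exact: cvg_cst|exact: cth].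
move=> s; apply: cvgD; last first.
  by apply: cvgMr; apply: cvg_dot; exact: cth'.
apply: cvgD; last first.
  by apply: cvgMr; apply: cvg_dot; [exact: ceR|exact: cJ].
apply: cvgD; first by apply: cvgMr; apply: cvg_dot; [exact: ceO|exact: cJ].
apply: cvgMr; apply: cvgMr; apply: cvg_mxtrace; apply: cvgB; last exact: cQ.
exact: cvg_cst.
Qed.

Hypothesis al_gt0 : 0 < al.
Hypothesis decay : forall y z : K, al * (y ^+ 2 + z ^+ 2) <=
  c2 * kR * y ^+ 2 + (kO - 2 * c2 * lM) * z ^+ 2 - c2 * (kO + B2) * y * z.

Lemma lyapunov_le t : timespan t0 T t -> lyapunov t <= lyapunov t0.
Proof.
move=> tT; move: (tT.1); rewrite le_eqVlt => /predU1P[<- //|t0t].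
have sub c : t0 <= c -> c <= t -> timespan t0 T c.
  by move=> t0c ct; split=> //; apply: le_lt_trans tT.2; rewrite lee_fin.
have [||c] := @MVT _ lyapunov (derive1 lyapunov) t0 t t0t.
- move=> c; rewrite in_itv /= => /andP[t0c ct].
  have [dV _] := is_derive_lyapunov (sub _ (ltW t0c) (ltW ct)) t0c.
  exact: is_derive1_derive.
- exact: within_continuous_lyapunov.
rewrite in_itv /= => /andP[t0c ct] VE.
have := derive1_lyapunov_le (sub _ (ltW t0c) (ltW ct)) t0c decay.
move=> dV; have dV0 : derive1 lyapunov c <= 0.
  apply: (le_trans dV); rewrite oppr_le0 mulr_ge0 ?(ltW al_gt0) //.
  by rewrite addr_ge0 // dot_ge0.
have : derive1 lyapunov c * (t - t0) <= 0.
  by rewrite mulr_le0_ge0 ?subr_ge0 ?(ltW t0t).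
by rewrite -VE subr_le0.
Qed.

Lemma lyapunov_ge : eigenvalue J lm ->
  (forall b, eigenvalue J b -> lm <= b) -> 0 <= kR ->
  forall t, timespan t0 T t ->
  2^-1 * kR * norm2 (eR t) ^+ 2 + 2^-1 * lm * norm2 (eO t) ^+ 2
  - c2 * lM * norm2 (eR t) * norm2 (eO t)
  + (2 * gamR)^-1 * norm2 (th t) ^+ 2 <= lyapunov t.
Proof.
move=> lm_eigen lm_min kR0 t tT; have [sRd sR _] := timespan_SO3 tT.
have h1 := rayleigh_ge J_posdef.1 lm_min (eO t).
have h2 : kR * norm2 (eR t) ^+ 2 <= kR * (2 * att_fun (Rd t) (R t)).
  rewrite ler_wpM2l // err_R_sqr //.
  by have := sqr_ge0 (att_fun (Rd t) (R t)); lra.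
have h3 : - (lM * (norm2 (eR t) * norm2 (eO t))) <= dot (eR t) (J *m eO t).
  rewrite lerNl; apply: le_trans (posdefmx_dot_le J_posdef lM_eigen lM_max _ _).
  by rewrite -normrN ler_norm.
move: h3; rewrite -(ler_pM2l c2_gt0) /lyapunov -(norm2_sqr (th t)) => h3.
by move: h1 h2 h3; rewrite -norm2_sqr; lra.
Qed.

Lemma lyapunov_init_le (psi : K) : timespan t0 T t0 -> psi < 2 ->
  att_fun (Rd t0) (R t0) <= psi -> 0 <= kR ->
  lyapunov t0 <= kR / (2 - psi) * norm2 (eR t0) ^+ 2
    + 2^-1 * lM * norm2 (eO t0) ^+ 2
    + c2 * lM * norm2 (eR t0) * norm2 (eO t0)
    + (2 * gamR)^-1 * norm2 (th t0) ^+ 2.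
Proof.
move=> tT psi2 att_le kR0; have [sRd sR _] := timespan_SO3 tT.
have h1 := rayleigh_le J_posdef.1 lM_max (eO t0).
have h2 : kR * att_fun (Rd t0) (R t0) <= kR / (2 - psi) * norm2 (eR t0) ^+ 2.
  rewrite -mulrA ler_wpM2l // mulrC ler_pdivlMr ?subr_gt0 // err_R_sqr //.
  rewrite ler_wpM2l ?att_fun_ge0 //; lra.
have h3 : dot (eR t0) (J *m eO t0) <= lM * (norm2 (eR t0) * norm2 (eO t0)).
  apply: le_trans (posdefmx_dot_le J_posdef lM_eigen lM_max _ _).
  exact: ler_norm.
move: h3; rewrite -(ler_pM2l c2_gt0) /lyapunov -(norm2_sqr (th t0)) => h3.
by move: h1 h2 h3; rewrite -norm2_sqr; lra.
Qed.

Section Convergence.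
Variables E H : K.
Hypothesis T_infty : T = +oo%E.
Hypothesis lyapunov_ge0 : forall t, timespan t0 T t -> 0 <= lyapunov t.
Hypothesis eO_le : forall t, timespan t0 T t -> norm2 (eO t) <= E.
Hypothesis th_le : forall t, timespan t0 T t -> norm2 (th t) <= H.

Let timespanT t : t0 <= t -> timespan t0 T t.
Proof. by move=> t0t; split=> //; rewrite T_infty ltry. Qed.

Lemma cvg_error (u : K -> 'cV[K]_3) (L : K) :
  (forall t, t0 < t ->
     dot (u t) (u t) <= dot (eR t) (eR t) + dot (eO t) (eO t)) ->
  (forall t, t0 < t -> exists2 du, is_derive t 1 u du &
     norm2 du * norm2 (u t) <= L) ->
  u t @[t --> +oo] --> (0 : 'cV[K]_3).
Proof.
move=> u_le du_le; apply: cvg_norm2_sqr0.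
under eq_fun do rewrite norm2_sqr.
pose n t := dot (u t) (u t).
apply: (@barbalat _ lyapunov n (derive1 lyapunov) (derive1 n) t0 al
  (2 * L)) => //.
- move=> t t0t; have [dV _] := is_derive_lyapunov (timespanT (ltW t0t)) t0t.
  exact: is_derive1_derive.
- move=> t /du_le [du hu _]; have [dn _] := is_derive_dot hu hu.
  exact: is_derive1_derive.
- by move=> t /ltW /timespanT; exact: lyapunov_ge0.
- by move=> t _; exact: dot_ge0.
- move=> t t0t; have := derive1_lyapunov_le (timespanT (ltW t0t)) t0t decay.
  move=> /le_trans; apply.
  by rewrite lerN2 ler_pM2l // u_le.
move=> t /du_le [du hu du_le']; have hn := is_derive_dot hu hu.
have -> : derive1 n t = 2 * dot du (u t).
  by rewrite derive1E (@derive_val _ _ _ _ _ _ _ hn) (dotC (u t)); ring.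
rewrite normrM ger0_norm // ler_wpM2l //.
exact: le_trans (CauchySchwarz _ _) du_le'.
Qed.

Lemma cvg_eR : eR t @[t --> +oo] --> (0 : 'cV[K]_3).
Proof.
apply: (@cvg_error _ E) => t t0t; first by rewrite lerDl dot_ge0.
have tT := timespanT (ltW t0t); have [sRd sR _] := timespan_SO3 tT.
exists (2^-1 *: ((\tr (Q t))%:M *m eO t - (Q t)^T *m eO t)).
  exact: is_derive_eR.
rewrite -[E]mulr1; apply: ler_pM; rewrite ?norm2_ge0 ?norm2_err_R_le1 //.
exact: le_trans (norm2_deR tT) (eO_le tT).
Qed.

Lemma cvg_eO (BW : K) : eigenvalue J lm ->
  (forall b, eigenvalue J b -> lm <= b) -> 0 <= kR ->
  (forall t, t0 <= t -> mxnorm2 (W t) <= BW) ->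
  eO t @[t --> +oo] --> (0 : 'cV[K]_3).
Proof.
move=> lm_eigen lm_min kR0 W_le.
have lm_gt0 := posdefmx_eigenvalue_gt0 J_posdef lm_eigen.
(* One summand for each term of J de_Omega/dt, with |e_R| <= 1; dividing by the least eigenvalue
   gives a bound on |de_Omega/dt|. *)
pose D := ((lM * E + B2) * E + kR + kO * E + BW * H) / lm.
apply: (@cvg_error _ (D * E)) => t t0t; first by rewrite lerDr dot_ge0.
have tT := timespanT (ltW t0t); have [sRd sR _] := timespan_SO3 tT.
have [deO heO JdeO] := is_derive_eO tT t0t; exists deO => //.
apply: ler_pM; rewrite ?norm2_ge0 ?eO_le //.
rewrite ler_pdivlMr // mulrC.
apply: le_trans (posdefmx_norm_ge J_posdef deO lm_eigen lm_min) _.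
rewrite JdeO; apply: (le_trans (norm2D _ _)); apply: lerD.
  apply: (le_trans (norm2D _ _)); rewrite norm2N; apply: lerD.
    apply: (le_trans (norm2D _ _)); rewrite norm2N; apply: lerD.
      apply: (le_trans (norm2_cross _ _)).
      apply: ler_pM; rewrite ?norm2_ge0 ?eO_le //.
      apply: (le_trans (norm2D _ _)); apply: lerD.
        apply: le_trans (posdefmx_norm_le J_posdef lM_eigen lM_max _) _.
        by rewrite ler_pM2l // eO_le.
      exact: norm2_desired_inertia.
    rewrite norm2Z ger0_norm // -[leRHS]mulr1 ler_wpM2l //.
    exact: norm2_err_R_le1.
  by rewrite norm2Z gtr0_norm // ler_pM2l // eO_le.
apply: (le_trans (norm2_mulmx _ _)).
by apply: ler_pM; rewrite ?mxnorm2_ge0 ?norm2_ge0 ?th_le ?W_le // ltW.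
Qed.

End Convergence.
End ClosedLoop.

(** k is the determinant of the form divided by its trace, hence below its least eigenvalue.
    Completing the square then leaves exactly k^2 z^2. *)
Lemma quadratic_coercive (K : realType) (a b c : K) :
  0 < a -> 0 < b -> c ^+ 2 < 4 * a * b ->
  exists2 k, 0 < k & forall y z,
    k * (y ^+ 2 + z ^+ 2) <= a * y ^+ 2 + b * z ^+ 2 - c * y * z.
Proof.
move=> a0 b0 cab; have ab0 : 0 < 4 * (a + b) by rewrite mulr_gt0 // addr_gt0.
pose k := (4 * a * b - c ^+ 2) / (4 * (a + b)).
have kE : k * (4 * (a + b)) = 4 * a * b - c ^+ 2 by rewrite divfK ?gt_eqF.
exists k; first by rewrite divr_gt0 // subr_gt0.
move=> y z; rewrite -subr_ge0.
have ka : 0 < a - k.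
  rewrite subr_gt0 /k ltr_pdivrMr //.
  by have := sqr_ge0 c; have := mulr_gt0 a0 a0; lra.
rewrite -(pmulr_rge0 _ ka).
have -> : (a - k) *
    (a * y ^+ 2 + b * z ^+ 2 - c * y * z - k * (y ^+ 2 + z ^+ 2))
  = ((a - k) * y - c / 2 * z) ^+ 2 + k ^+ 2 * z ^+ 2
    + (4 * a * b - c ^+ 2 - k * (4 * (a + b))) / 4 * z ^+ 2 by field.
rewrite kE subrr !mul0r addr0.
by apply: addr_ge0; rewrite ?sqr_ge0 // mulr_ge0 ?sqr_ge0.
Qed.

(** * Choice of the constants; stability, boundedness and convergence *)

Theorem proposition2 (K : realType) (P : nat)
  (m g : K) (J : 'M[K]_3) (lm lM : K)
  (Wx WR : 'cV[K]_3 -> 'cV[K]_3 -> 'M[K]_3 -> 'cV[K]_3 -> 'M[K]_(3, P))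
  (thx thR : 'cV[K]_P) (BWx Bth : K)
  (Rd : K -> 'M[K]_3) (Omd : K -> 'cV[K]_3)
  (kR kO c2 gamR B2 : K)
  (m_gt0 : 0 < m)
  (J_posdef : posdefmx J)
  (lm_eigen : eigenvalue J lm)
  (lm_min : forall a, eigenvalue J a -> lm <= a)
  (lM_eigen : eigenvalue J lM)
  (lM_max : forall a, eigenvalue J a -> a <= lM)
  (BWx_gt0 : 0 < BWx) (Bth_gt0 : 0 < Bth)
  (Wx_bound : forall x v R Om, SO3 R -> mxnorm2 (Wx x v R Om) <= BWx)
  (thx_bound : norm2 thx <= Bth) (thR_bound : norm2 thR <= Bth)
  (Rd_smooth : forall (n : nat) (t : K), derivable (derive1n n Rd) t 1)
  (Rd_SO3 : forall t, 0 <= t -> SO3 (Rd t))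
  (Rd_kinematics : forall t, 0 <= t -> derive1 Rd t = Rd t *m hat (Omd t))
  (Omd_bounded : exists B : K, forall t, 0 <= t -> norm2 (Omd t) <= B)
  (kR_gt0 : 0 < kR) (kO_gt0 : 0 < kO) (c2_gt0 : 0 < c2) (gamR_gt0 : 0 < gamR)
  (B2_bound : forall t, 0 <= t ->
     mxnorm2 (2 *: J - (\tr J)%:M) * norm2 (Omd t) <= B2)
  (c2_bound : c2 < Num.min (Num.sqrt (kR * lm) / lM)
                           (4 * kR * kO / (8 * kR * lM + (kO + B2) ^+ 2))) :
  (* stability of the zero equilibrium in the sense of Lyapunov *)
  (forall t0 psi eps : K, 0 <= t0 -> psi < 2 -> 0 < eps ->
     exists2 delta : K, 0 < delta &
     forall (T : \bar K) (f : K -> K) (x v : K -> 'cV[K]_3)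
       (R : K -> 'M[K]_3) (Om : K -> 'cV[K]_3) (thb : K -> 'cV[K]_P),
       closed_loop m g J Wx WR thx thR kR kO c2 gamR Rd Omd
         t0 T f x v R Om thb ->
       att_fun (Rd t0) (R t0) <= psi ->
       norm2 (err_R (Rd t0) (R t0)) < delta ->
       norm2 (err_Omega (Rd t0) (R t0) (Omd t0) (Om t0)) < delta ->
       norm2 (thR - thb t0) < delta ->
       forall t, timespan t0 T t ->
         [/\ norm2 (err_R (Rd t) (R t)) < eps,
             norm2 (err_Omega (Rd t) (R t) (Omd t) (Om t)) < eps
           & norm2 (thR - thb t) < eps])
  /\
  (forall (t0 : K) (T : \bar K) (f : K -> K) (x v : K -> 'cV[K]_3)
     (R : K -> 'M[K]_3) (Om : K -> 'cV[K]_3) (thb : K -> 'cV[K]_P),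
     0 <= t0 ->
     closed_loop m g J Wx WR thx thR kR kO c2 gamR Rd Omd
       t0 T f x v R Om thb ->
     (* uniform boundedness of the estimation error *)
     (exists B : K, forall t, timespan t0 T t -> norm2 (thR - thb t) <= B)
     /\
     (* convergence of the tracking errors of complete solutions; for the
        second one, W_R is bounded along the solution *)
     (T = +oo%E ->
        (err_R (Rd t) (R t) @[t --> +oo] --> (0 : 'cV[K]_3))
        /\
        ((exists B : K, forall t, t0 <= t ->
            mxnorm2 (WR (x t) (v t) (R t) (Om t)) <= B) ->
         err_Omega (Rd t) (R t) (Omd t) (Om t) @[t --> +oo]
           --> (0 : 'cV[K]_3)))).
Proof.
have lm0 := posdefmx_eigenvalue_gt0 J_posdef lm_eigen.
have lM0 := posdefmx_eigenvalue_gt0 J_posdef lM_eigen.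
have kR0 := ltW kR_gt0.
have B2_ge0 : 0 <= B2.
  apply: le_trans (B2_bound 0 (lexx 0)).
  by rewrite mulr_ge0 ?mxnorm2_ge0 ?norm2_ge0.
move: c2_bound; rewrite lt_min => /andP[c2_sqrt c2_frac].
have c2_lm : (c2 * lM) ^+ 2 < kR * lm.
  rewrite -[ltRHS]sqr_sqrtr ?mulr_ge0 ?(ltW lm0) //.
  rewrite ltr_pXn2r ?nnegrE ?sqrtr_ge0 ?(mulr_ge0 (ltW c2_gt0) (ltW lM0)) //.
  by rewrite -ltr_pdivlMr.
have c2_kO : c2 * (8 * kR * lM + (kO + B2) ^+ 2) < 4 * kR * kO.
  have den : 0 < 8 * kR * lM + (kO + B2) ^+ 2.
    by rewrite ltr_wpDr ?sqr_ge0 // mulr_gt0 // mulr_gt0.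
  by rewrite -ltr_pdivlMr.
(* Dropping the square (k_Omega + B_2)^2 from the second bound on c_2 gives this; keeping it gives
   the discriminant condition for [decay]. *)
have kO_lM : 0 < kO - 2 * c2 * lM.
  rewrite -(pmulr_rgt0 _ (mulr_gt0 (ltr0n K 4) kR_gt0)).
  have := mulr_ge0 (ltW c2_gt0) (sqr_ge0 (kO + B2)).
  by move: c2_kO; lra.
have [al al0 decay] : exists2 k, 0 < k & forall y z, k * (y ^+ 2 + z ^+ 2) <=
    c2 * kR * y ^+ 2 + (kO - 2 * c2 * lM) * z ^+ 2 - c2 * (kO + B2) * y * z.
  apply: quadratic_coercive => //; first exact: mulr_gt0.
  have := c2_kO; rewrite -(ltr_pM2l c2_gt0); lra.
have [be be0 coercive] : exists2 k, 0 < k & forall y z,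
    k * (y ^+ 2 + z ^+ 2) <=
    2^-1 * kR * y ^+ 2 + 2^-1 * lm * z ^+ 2 - c2 * lM * y * z.
  apply: quadratic_coercive; rewrite ?mulr_gt0 ?invr_gt0 //.
  by move: c2_lm; lra.
pose ga := (2 * gamR)^-1.
have ga0 : 0 < ga by rewrite invr_gt0 mulr_gt0.
pose b := Num.min be ga.
have b0 : 0 < b by rewrite lt_min be0.
have V_ge t0 T f x v R Om thb : 0 <= t0 ->
    closed_loop m g J Wx WR thx thR kR kO c2 gamR Rd Omd t0 T f x v R Om thb ->
    forall t, timespan t0 T t ->
    b * (norm2 (err_R (Rd t) (R t)) ^+ 2
         + norm2 (err_Omega (Rd t) (R t) (Omd t) (Om t)) ^+ 2
         + norm2 (thR - thb t) ^+ 2)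
      <= lyapunov J thR Rd Omd kR c2 gamR R Om thb t.
  move=> t0_ge0 loop t tT.
  have := lyapunov_ge J_posdef lM_eigen lM_max Rd_SO3 c2_gt0 t0_ge0 loop
    lm_eigen lm_min kR0 tT.
  apply: le_trans; rewrite mulrDr; apply: lerD.
    apply: le_trans (coercive _ _); rewrite ler_wpM2r ?addr_ge0 ?sqr_ge0 //.
    by rewrite ge_min lexx.
  by rewrite ler_wpM2r ?sqr_ge0 // ge_min lexx orbT.
have V_le t0 T f x v R Om thb (t0_ge0 : 0 <= t0)
    (loop : closed_loop m g J Wx WR thx thR kR kO c2 gamR Rd Omd t0 T f x v R
              Om thb) t (tT : timespan t0 T t) :=
  lyapunov_le J_posdef lM_eigen lM_max Rd_smooth Rd_SO3 Rd_kinematics gamR_gt0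
    c2_gt0 kO_gt0 B2_bound t0_ge0 loop al0 decay tT.
split=> [t0 psi eps t0_ge0 psi2 eps0|t0 T f x v R Om thb t0_ge0 loop].
  (* The sum of the coefficients in [lyapunov_init_le]: initial errors below delta give V < C
     delta^2. Neither C nor the resulting delta depends on t0. *)
  pose C := kR / (2 - psi) + 2^-1 * lM + c2 * lM + ga.
  have C1 : 0 < kR / (2 - psi) by rewrite divr_gt0 // subr_gt0.
  have C3 : 0 < c2 * lM by rewrite mulr_gt0.
  have C0 : 0 < C by rewrite /C; lra.
  (* The cap at 1 gives r^2 <= r <= b / C, hence C (eps r)^2 <= b eps^2 without a square root. *)
  pose r := Num.min 1 (b / C).
  have r0 : 0 < r by rewrite lt_min ltr01 divr_gt0.
  have delta0 : 0 < eps * r by rewrite mulr_gt0.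
  have C_delta : C * (eps * r) ^+ 2 <= b * eps ^+ 2.
    have r1 : r * r <= b / C.
      apply: (@le_trans _ _ r); last by rewrite ge_min lexx orbT.
      by rewrite ger_pMr // ge_min lexx.
    have {}r1 : r * r * C <= b by rewrite -ler_pdivlMr.
    have := ler_wpM2r (sqr_ge0 eps) r1; lra.
  exists (eps * r) => // T f x v R Om thb loop att_le eR_lt eO_lt th_lt t tT.
  have t0T : timespan t0 T t0.
    by split=> //; apply: le_lt_trans tT.2; rewrite lee_fin tT.1.
  have sq (s : K) : 0 <= s -> s < eps * r -> s ^+ 2 < (eps * r) ^+ 2.
    by move=> s0; rewrite ltr_pXn2r ?nnegrE // ltW.
  have V0 : lyapunov J thR Rd Omd kR c2 gamR R Om thb t0 < b * eps ^+ 2.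
    apply: (le_lt_trans (lyapunov_init_le J_posdef lM_eigen lM_max Rd_SO3 c2_gt0
      t0_ge0 loop t0T psi2 att_le kR0)).
    apply: lt_le_trans C_delta; rewrite /C -/ga.
    have sqM (k s : K) : 0 < k -> 0 <= s -> s < eps * r ->
        k * s ^+ 2 < k * (eps * r) ^+ 2.
      by move=> k0 s0 lt_s; rewrite ltr_pM2l // sq.
    have q1 := sqM _ _ C1 (norm2_ge0 _) eR_lt.
    have q2 := sqM _ _ lM0 (norm2_ge0 _) eO_lt.
    have q3 := sqM _ _ ga0 (norm2_ge0 _) th_lt.
    have q4 : c2 * lM * (norm2 (err_R (Rd t0) (R t0)) *
        norm2 (err_Omega (Rd t0) (R t0) (Omd t0) (Om t0)))
        <= c2 * lM * (eps * r) ^+ 2.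
      by rewrite ler_pM2l // expr2 ler_pM ?norm2_ge0 // ltW.
    by move: q1 q2 q3 q4; lra.
  have := V_ge _ _ _ _ _ _ _ _ t0_ge0 loop t tT.
  move=> /le_trans /(_ (V_le _ _ _ _ _ _ _ _ t0_ge0 loop t tT)).
  move=> /le_lt_trans /(_ V0); rewrite ltr_pM2l // => lt_eps.
  have small (s : K) : 0 <= s -> s ^+ 2 < eps ^+ 2 -> s < eps.
    by move=> s0; rewrite ltr_pXn2r ?nnegrE // ltW.
  have p1 := sqr_ge0 (norm2 (err_R (Rd t) (R t))).
  have p2 := sqr_ge0 (norm2 (err_Omega (Rd t) (R t) (Omd t) (Om t))).
  have p3 := sqr_ge0 (norm2 (thR - thb t)).
  by split; apply: small; rewrite ?norm2_ge0 //; lra.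
pose V0 := lyapunov J thR Rd Omd kR c2 gamR R Om thb t0.
have bound (s : K) : 0 <= s -> b * s ^+ 2 <= V0 -> s <= Num.sqrt (V0 / b).
  move=> s0 sV; rewrite -[s]ger0_norm // -sqrtr_sqr ler_wsqrtr //.
  by rewrite ler_pdivlMr // mulrC.
have bounds t : timespan t0 T t ->
    norm2 (err_Omega (Rd t) (R t) (Omd t) (Om t)) <= Num.sqrt (V0 / b) /\
    norm2 (thR - thb t) <= Num.sqrt (V0 / b).
  move=> tT; have := V_ge _ _ _ _ _ _ _ _ t0_ge0 loop t tT.
  move=> /le_trans /(_ (V_le _ _ _ _ _ _ _ _ t0_ge0 loop t tT)) hV.
  have p1 := mulr_ge0 (ltW b0) (sqr_ge0 (norm2 (err_R (Rd t) (R t)))).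
  have p2 := mulr_ge0 (ltW b0)
    (sqr_ge0 (norm2 (err_Omega (Rd t) (R t) (Omd t) (Om t)))).
  have p3 := mulr_ge0 (ltW b0) (sqr_ge0 (norm2 (thR - thb t))).
  by split; apply: bound; rewrite ?norm2_ge0 //; move: hV; rewrite -/V0; lra.
have eO_le t (tT : timespan t0 T t) := (bounds t tT).1.
have th_le t (tT : timespan t0 T t) := (bounds t tT).2.
have V_ge0 t : timespan t0 T t ->
    0 <= lyapunov J thR Rd Omd kR c2 gamR R Om thb t.
  move=> tT; apply: le_trans (V_ge _ _ _ _ _ _ _ _ t0_ge0 loop t tT).
  by rewrite mulr_ge0 ?(ltW b0) // !addr_ge0 ?sqr_ge0.
split; first by exists (Num.sqrt (V0 / b)).
move=> T_infty; split.
  exact: (cvg_eR J_posdef lM_eigen lM_max Rd_smooth Rd_SO3 Rd_kinematics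
    gamR_gt0 c2_gt0 kO_gt0 B2_bound t0_ge0 loop al0 decay T_infty V_ge0 eO_le).
case=> BW W_le.
exact: (cvg_eO J_posdef lM_eigen lM_max Rd_smooth Rd_SO3 Rd_kinematics gamR_gt0
  c2_gt0 kO_gt0 B2_bound t0_ge0 loop al0 decay T_infty V_ge0 eO_le th_le
  lm_eigen lm_min kR0 W_le).
Qed.
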